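(* Let $C_A=(G_0,G_1,\dots,G_{m-1})$ be an $n$-qubit circuit and let $A = U_{G_{m-1}}\cdots U_{G_1}U_{G_0}$ be the corresponding unitary. For a Pauli string $\mathbf P^0$ let $F_{\mathbf P^m} := F_{\mathbf P^0}\wedge\bigwedge_{i=0}^{m-1}F_{G_i}$ be the Boolean encoding of $\mathbf P^m := A\mathbf P^0A^\dagger$, with its weight function $W$ (encoding and weights as defined in the context). Then for every $\mathbf P^0\in\{X_j,Z_j \mid j\in[n]\}$ and every Pauli string $P\in\hat{\mathcal P}_n$, the weighted model count of $F_{\mathbf P^m}\wedge F_P$ equals the Pauli coefficient of $P$ in $A\mathbf P^0A^\dagger$, i.e. $$MC_W(F_{\mathbf P^m}\wedge F_P)=\frac{1}{2^n}\operatorname{Tr}\bigl(P^\dagger\cdot A\mathbf P^0A^\dagger\bigr).$$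
   Context: Pauli strings. $[n]=\{1,\dots,n\}$, $n\ge 1$. Write $\sigma[0,0]=I=\begin{pmatrix}1&0\\0&1\end{pmatrix}$, $\sigma[0,1]=Z=\begin{pmatrix}1&0\\0&-1\end{pmatrix}$, $\sigma[1,0]=X=\begin{pmatrix}0&1\\1&0\end{pmatrix}$, $\sigma[1,1]=Y=\begin{pmatrix}0&-i\\i&0\end{pmatrix}$. The set of Pauli strings is $\hat{\mathcal P}_n=\{P_1\otimes\cdots\otimes P_n\mid P_j\in\{I,X,Y,Z\}\}$. For a single-qubit operator $U$, $U_j=I^{\otimes j-1}\otimes U\otimes I^{\otimes n-j}$. Every $2^n\times 2^n$ complex matrix $M$ is uniquely $M=\sum_{P\in\hat{\mathcal P}_n}\gamma_P P$ with Pauli coefficient $\gamma_P=\frac1{2^n}\operatorname{Tr}(P^\dagger M)$. Gates. A circuit is a list of gates $G_0,\dots,G_{m-1}$ ($m\ge1$), each one of $H_j,S_j,CZ_{jk},T_j,\mathrm{Toffoli}_{jkl},R_X(\theta)_j$ with $j,k,l\in[n]$ distinct and $\theta$ real, where $H=\frac1{\sqrt2}\begin{pmatrix}1&1\\1&-1\end{pmatrix}$, $S=\mathrm{diag}(1,i)$, $T=\mathrm{diag}(1,e^{i\pi/4})$, $R_X(\theta)=\begin{pmatrix}\cos(\theta/2)&-i\sin(\theta/2)\\-i\sin(\theta/2)&\cos(\theta/2)\end{pmatrix}$, $CZ=\mathrm{diag}(1,1,1,-1)$ (acting on qubits $j,k$), and $\mathrm{Toffoli}$ flips qubit $l$ iff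 qubits $j,k$ are both $1$ in the computational basis. $U_G$ is the $n$-qubit unitary of gate $G$. Weighted model counting. For a Boolean formula $F$ over a finite set $V$ of variables and a weight function $W$ assigning a real number to each literal $x,\overline x$ ($x\in V$), $MC_W(F)=\sum_{\alpha\in\{0,1\}^V}F(\alpha)\,W(\alpha)$, where $W(\alpha)$ is the product over $x\in V$ of $W(x)$ if $\alpha(x)=1$ and $W(\overline x)$ if $\alpha(x)=0$. Encoding. The variables are $x_j^t,z_j^t$ ($j\in[n]$) and $r^t$ for $t=0,\dots,m$, plus the auxiliary variables $u$ introduced below for certain gates. The initial formula $F_{\mathbf P^0}$ for $\mathbf P^0=\bigotimes_j\sigma[a_j,b_j]$ is the conjunction of literals forcing $x_j^0=a_j$, $z_j^0=b_j$ for all $j$, and $r^0=0$. The final formula $F_P$ for $P=\bigotimes_j\sigma[a_j,b_j]$ is the conjunction of literals forcing $x_j^m=a_j$, $z_j^m=b_j$ for all $j$ (with $r^m$ unconstrained). For a gate $G_t$ the constraint $F_{G_t}$ is the conjunction of the formulas listed below ($\oplus$ is exclusive or, juxtaposition is conjunction), together with $a^{t+1}\Leftrightarrow a^t$ for each $a\in\{x_j,z_j\mid j\in[n]\}\cup\{r\}$ whose time-$(t+1)$ copy does not occur in the listed formulas: - $H_j$: $r^{t+1}\Leftrightarrow r^t\oplus x_j^tz_j^t$; $z_j^{t+1}\Leftrightarrow x_j^t$; $x_j^{t+1}\Leftrightarrow z_j^t$. - $S_j$: $r^{t+1}\Leftrightarrow r^t\oplus x_j^tz_j^t$; $z_j^{t+1}\Leftrightarrow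 x_j^t\oplus z_j^t$. - $CZ_{jk}$: $r^{t+1}\Leftrightarrow r^t\oplus x_j^tx_k^t(z_k^t\oplus z_j^t)$; $z_k^{t+1}\Leftrightarrow z_k^t\oplus x_j^t$; $z_j^{t+1}\Leftrightarrow z_j^t\oplus x_k^t$. - $T_j$: $x_j^{t+1}\Leftrightarrow x_j^t$; $x_j^t\vee(z_j^{t+1}\Leftrightarrow z_j^t)$; $r^{t+1}\Leftrightarrow r^t\oplus x_j^tz_j^t\overline{z_j^{t+1}}$; $u^t\Leftrightarrow x_j^t$, with a new variable $u^t$. - $R_X(\theta)_j$: $z_j^t\vee(x_j^{t+1}\Leftrightarrow x_j^t)$; $z_j^{t+1}\Leftrightarrow z_j^t$; $r^{t+1}\Leftrightarrow r^t\oplus \overline{x_j^t}z_j^tx_j^{t+1}$; $u_c^t\Leftrightarrow z_j^t(x_j^{t+1}\Leftrightarrow x_j^t)$; $u_s^t\Leftrightarrow z_j^t(x_j^{t+1}\oplus x_j^t)$, with new variables $u_c^t,u_s^t$. - $\mathrm{Toffoli}_{jkl}$: let $P^t,P^{t+1}$ denote the three-qubit Pauli strings $\bigotimes_{q\in(j,k,l)}\sigma[x_q^t,z_q^t]$ and $\bigotimes_{q\in(j,k,l)}\sigma[x_q^{t+1},z_q^{t+1}]$, and let $c(P,Q)=\frac18\operatorname{Tr}(Q\cdot\mathrm{Toffoli}\,P\,\mathrm{Toffoli}^\dagger)\in\{0,\pm\frac12,\pm1\}$. The constraint states that $c(P^t,P^{t+1})\neq0$, that $r^{t+1}\Leftrightarrow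 r^t\oplus[c(P^t,P^{t+1})<0]$, and that $u^t\Leftrightarrow[\,|c(P^t,P^{t+1})|=\frac12\,]$, with a new variable $u^t$. Weights. $W(r^m)=-1$ and $W(\overline{r^m})=1$; for a $T$ gate at time $t$: $W(u^t)=\frac1{\sqrt2}$, $W(\overline{u^t})=1$; for a Toffoli gate: $W(u^t)=\frac12$, $W(\overline{u^t})=1$; for $R_X(\theta)$: $W(u_c^t)=\cos\theta$, $W(u_s^t)=\sin\theta$, $W(\overline{u_c^t})=W(\overline{u_s^t})=1$. All other literals have weight $1$. *)

(* Defs.v *)
From mathcomp Require Import all_boot all_order all_algebra.
From mathcomp Require Import complex mxtens.
From mathcomp Require Import reals trigo.

Set Implicit Arguments.
Unset Strict Implicit.
Unset Printing Implicit Defensive.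

Import Order.TTheory GRing.Theory Num.Theory.

Local Open Scope ring_scope.
Local Open Scope complex_scope.

(** * Operators on n qubits *)

Definition mx2 (K : Type) (a b c d : K) : 'M[K]_2 :=
  \matrix_(i, j) if i == 0 then (if j == 0 then a else b)
                 else (if j == 0 then c else d).

Definition dagger (R : rcfType) (p q : nat) (M : 'M[R[i]]_(p, q)) :
  'M[R[i]]_(q, p) := (map_mx Num.conj M)^T.

(* M_0 (x) M_1 (x) ... (x) M_(n-1); qubit 0 is the leftmost factor.  The cast
   only identifies 2 * 2 ^ n with 2 ^ n.+1. *)
Fixpoint tensor (K : pzRingType) (n : nat) :
  ('I_n -> 'M[K]_2) -> 'M[K]_(2 ^ n) :=
  match n return ('I_n -> 'M[K]_2) -> 'M[K]_(2 ^ n) with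
  | 0 => fun _ => 1%:M
  | n'.+1 => fun M =>
      castmx (esym (expnS 2 n'), esym (expnS 2 n'))
             (M ord0 *t tensor (fun j => M (lift ord0 j)))
  end.

(* The operator written U_j: U on qubit j and the identity elsewhere. *)
Definition on_qubit (K : pzRingType) (n : nat) (U : 'M[K]_2) (j : 'I_n) :
  'M[K]_(2 ^ n) := tensor (fun k => if k == j then U else 1%:M).

(* A basis state is an index a < 2 ^ n, and qbit a j is the value of qubit j in
   it.  Qubit 0 is the most significant binary digit, which is what the
   Kronecker product dictates: see tensorE. *)
Definition qbit (n : nat) (a : 'I_(2 ^ n)) (j : 'I_n) : bool :=
  odd (a %/ 2 ^ (n - j.+1)).

Lemma tensorE (K : comPzRingType) (n : nat) (M : 'I_n -> 'M[K]_2)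
    (a b : 'I_(2 ^ n)) :
  tensor M a b = \prod_(j < n) M j (inord (qbit a j)) (inord (qbit b j)).
Proof.
elim: n M a b => [|n IHn] M a b.
  by rewrite big_ord0 /= !ord1 mxE.
have digit0 (c : 'I_(2 ^ n.+1)) (c' : 'I_(2 * 2 ^ n)) : c = c' :> nat ->
    (mxtens_unindex c').1 = inord (qbit c ord0).
  move=> cc'; apply: val_inj; rewrite /= inordK; last by case: (qbit _ _).
  rewrite /qbit /= subn1 /= cc'.
  have : (c' %/ 2 ^ n < 2)%N by rewrite ltn_divLR ?expn_gt0 // ltn_ord.
  by case: (c' %/ 2 ^ n)%N => [|[]].
have digitS (c : 'I_(2 ^ n.+1)) (c' : 'I_(2 * 2 ^ n)) (j : 'I_n) :
    c = c' :> nat ->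
    qbit (mxtens_unindex c').2 j = qbit c (lift ord0 j).
  move=> cc'; rewrite /qbit /= cc' /bump /= add1n subSS.
  have e2n : (2 ^ n = 2 ^ j.+1 * 2 ^ (n - j.+1))%N by rewrite -expnD subnKC.
  rewrite [in RHS](divn_eq c' (2 ^ n)) [X in (_ * X + _)%N]e2n mulnA.
  by rewrite divnMDl ?expn_gt0 // oddD oddM oddX andbF.
rewrite big_ord_recl /= castmxE !esymK.
set a' := cast_ord _ a; set b' := cast_ord _ b.
rewrite -(mxtens_unindexK a') -(mxtens_unindexK b').
case Ea: (mxtens_unindex a') => [a1 a2]; case Eb: (mxtens_unindex b') => [b1 b2].
rewrite tensmxE IHn; congr (_ * _).
  by rewrite -(digit0 a a') // -(digit0 b b') // Ea Eb.
apply: eq_bigr => j _.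
by rewrite -(digitS a a') // -(digitS b b') // Ea Eb.
Qed.

(** * Pauli strings *)

Definition sigma (R : rcfType) (p : bool * bool) : 'M[R[i]]_2 :=
  match p with
  | (false, false) => mx2 1 0 0 1
  | (false, true)  => mx2 1 0 0 (- 1)
  | (true, false)  => mx2 0 1 1 0
  | (true, true)   => mx2 0 (- 'i) 'i 0
  end.

(* A Pauli string is given by its labels (a_j, b_j)_j. *)
Definition pauli_string (n : nat) : finType := {ffun 'I_n -> bool * bool}.

Definition pauli_mx (R : rcfType) (n : nat) (P : pauli_string n) :
  'M[R[i]]_(2 ^ n) := tensor (fun j => sigma R (P j)).

(** * Gates and circuits *)

Inductive gate (R : realType) (n : nat) : Type :=
| GH (j : 'I_n)
| GS (j : 'I_n)
| GCZ (j k : 'I_n) of j != k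
| GT (j : 'I_n)
| GToffoli (j k l : 'I_n) of uniq [:: j; k; l]
| GRX (theta : R) (j : 'I_n).

Definition cz_mx (K : pzRingType) (n : nat) (j k : 'I_n) : 'M[K]_(2 ^ n) :=
  \matrix_(a, b) if a == b then (if qbit a j && qbit a k then - 1 else 1) else 0.

Definition toffoli_mx (K : pzRingType) (n : nat) (j k l : 'I_n) :
  'M[K]_(2 ^ n) :=
  \matrix_(a, b)
    if [forall q, qbit a q
          == (if q == l then qbit b q (+) (qbit b j && qbit b k) else qbit b q)]
    then 1 else 0.

Definition gate_mx (R : realType) (n : nat) (g : gate R n) :
  'M[R[i]]_(2 ^ n) :=
  match g with
  | GH j => on_qubit (((Num.sqrt 2)^-1)%:C *: mx2 1 1 1 (- 1)) j
  | GS j => on_qubit (mx2 1 0 0 'i) j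
  | GCZ j k _ => cz_mx _ j k
  | GT j => on_qubit (mx2 1 0 0 (cos (pi / 4) +i* sin (pi / 4))) j
  | GToffoli j k l _ => toffoli_mx _ j k l
  | GRX theta j =>
      let c := (cos (theta / 2))%:C in
      let s := (sin (theta / 2))%:C in
      on_qubit (mx2 c (- 'i * s) (- 'i * s) c) j
  end.

Definition circuit_mx (R : realType) (n : nat) (C : seq (gate R n)) :
  'M[R[i]]_(2 ^ n) := foldl (fun A g => gate_mx g *m A) 1%:M C.

(** * Boolean formulas and weighted model counting *)

Inductive formula (V : Type) : Type :=
| FConst of bool
| FVar of V
| FNot of formula V
| FAnd of formula V & formula V
| FOr of formula V & formula V
| FXor of formula V & formula V
| FImp of formula V & formula V
| FIff of formula V & formula V.

Arguments FConst {V}.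

Fixpoint feval (V : Type) (alpha : V -> bool) (F : formula V) : bool :=
  match F with
  | FConst b => b
  | FVar v => alpha v
  | FNot F1 => ~~ feval alpha F1
  | FAnd F1 F2 => feval alpha F1 && feval alpha F2
  | FOr F1 F2 => feval alpha F1 || feval alpha F2
  | FXor F1 F2 => feval alpha F1 (+) feval alpha F2
  | FImp F1 F2 => feval alpha F1 ==> feval alpha F2
  | FIff F1 F2 => feval alpha F1 == feval alpha F2
  end.

Fixpoint fvars (V : Type) (F : formula V) : seq V :=
  match F with
  | FConst _ => [::]
  | FVar v => [:: v]
  | FNot F1 => fvars F1
  | FAnd F1 F2 | FOr F1 F2 | FXor F1 F2 | FImp F1 F2 | FIff F1 F2 =>
      fvars F1 ++ fvars F2
  end.

Definition FLit (V : Type) (v : V) (b : bool) : formula V :=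
  if b then FVar v else FNot (FVar v).

Notation "\FAnd_ ( i 'in' T | P ) F" :=
  (\big[@FAnd _/FConst true]_(i : T | P) F)
  (at level 41, F at level 41, i at level 50).
Notation "\FAnd_ ( i 'in' T ) F" :=
  (\big[@FAnd _/FConst true]_(i : T) F)
  (at level 41, F at level 41, i at level 50).

(* W v b is the weight of the literal v (b = true) or of its negation. *)
Definition model_count (R : pzRingType) (V : finType) (W : V -> bool -> R)
    (F : formula V) : R :=
  \sum_(alpha : {ffun V -> bool})
    (feval alpha F)%:R * \prod_(v : V) W v (alpha v).

(** * The encoding *)

(* Untimed state variables: x_j, z_j and r. *)
Definition state_var (n : nat) : finType := option ('I_n + 'I_n)%type.
Definition sx (n : nat) (j : 'I_n) : state_var n := Some (inl j).
Definition sz (n : nat) (j : 'I_n) : state_var n := Some (inr j).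
Definition sr (n : nat) : state_var n := None.
Arguments sr {n}.

(* Indices of the auxiliary variables of a gate: tt is u; for a rotation, true
   is u_c and false is u_s. *)
Definition aux (R : realType) (n : nat) (g : gate R n) : finType :=
  match g with
  | GT _ | GToffoli _ _ _ _ => unit
  | GRX _ _ => bool
  | _ => void
  end.

Definition aux_weight (R : realType) (n : nat) (g : gate R n) : aux g -> R :=
  match g return aux g -> R with
  | GT _ => fun _ => (Num.sqrt 2)^-1
  | GToffoli _ _ _ _ => fun _ => 2^-1
  | GRX theta _ => fun i => if i then cos theta else sin theta
  | _ => fun _ => 1
  end.

Definition toffoli_coef (R : rcfType) (P Q : pauli_string 3) : R[i] :=
  let Tof : 'M[R[i]]_(2 ^ 3) := toffoli_mx _ (inord 0) (inord 1) (inord 2) in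
  8^-1 * \tr (pauli_mx R Q *m (Tof *m pauli_mx R P *m dagger Tof)).

Section Encoding.

Variables (R : realType) (n : nat) (V : eqType).

(* x', z' and r' below are the copies at time t + 1 of x, z and r. *)
Variables cur nxt : state_var n -> V.

Local Notation x j := (FVar (cur (sx j))).
Local Notation z j := (FVar (cur (sz j))).
Local Notation r := (FVar (cur sr)).
Local Notation x' j := (FVar (nxt (sx j))).
Local Notation z' j := (FVar (nxt (sz j))).
Local Notation r' := (FVar (nxt sr)).
Local Notation "F <=>F G" := (FIff F G) (at level 70).
Local Notation "F 'xor' G" := (FXor F G) (at level 50, left associativity).
Local Notation "F 'and' G" := (FAnd F G) (at level 40, left associativity).
Local Notation "F 'or' G" := (FOr F G) (at level 50, left associativity).

Definition pauli_formula (m : nat) (q : 'I_m -> 'I_n) (s : state_var n -> V)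
    (P : pauli_string m) : formula V :=
  \FAnd_(i in 'I_m)
    FAnd (FLit (s (sx (q i))) (P i).1) (FLit (s (sz (q i))) (P i).2).

(* The constraint on c(P^t, P^(t+1)) is spelled out value by value: whenever
   the current labels are those of P and the next ones those of Q, what is
   required holds for the number c(P, Q). *)
Definition toffoli_formula (j k l : 'I_n) (u : V) : formula V :=
  let q := tnth [tuple j; k; l] in
  \FAnd_(P in pauli_string 3) \FAnd_(Q in pauli_string 3)
    FImp (pauli_formula q cur P and pauli_formula q nxt Q)
         (let c := toffoli_coef R P Q in
          FConst (c != 0)
          and (r' <=>F r xor FConst (c < 0))
          and (FVar u <=>F FConst (`|c| == 2^-1))).

Definition listed_formula (g : gate R n) : (aux g -> V) -> formula V :=
  match g return (aux g -> V) -> formula V with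
  | GH j => fun _ =>
      (r' <=>F r xor x j and z j) and (z' j <=>F x j) and (x' j <=>F z j)
  | GS j => fun _ =>
      (r' <=>F r xor x j and z j) and (z' j <=>F x j xor z j)
  | GCZ j k _ => fun _ =>
      (r' <=>F r xor x j and x k and (z k xor z j))
      and (z' k <=>F z k xor x j)
      and (z' j <=>F z j xor x k)
  | GT j => fun u =>
      (x' j <=>F x j)
      and (x j or (z' j <=>F z j))
      and (r' <=>F r xor x j and z j and FNot (z' j))
      and (FVar (u tt) <=>F x j)
  | GToffoli j k l _ => fun u => toffoli_formula j k l (u tt)
  | GRX _ j => fun u =>
      let uc := FVar (u true) in
      let us := FVar (u false) in
      (z j or (x' j <=>F x j))
      and (z' j <=>F z j)
      and (r' <=>F r xor FNot (x j) and z j and x' j)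
      and (uc <=>F z j and (x' j <=>F x j))
      and (us <=>F z j and (x' j xor x j))
  end.

Definition gate_formula (g : gate R n) (u : aux g -> V) : formula V :=
  let F := listed_formula u in
  FAnd F (\FAnd_(a in state_var n | nxt a \notin fvars F)
            (FVar (nxt a) <=>F FVar (cur a))).

End Encoding.

Section Circuit.

Variables (R : realType) (n m : nat) (C : m.-tuple (gate R n)).

(* A state variable with its time in {0, ..., m}, or an auxiliary variable of
   the gate at some time t < m. *)
Definition var : finType :=
  ((state_var n * 'I_m.+1) + {t : 'I_m & aux (tnth C t)})%type.

Definition at_time (t : 'I_m.+1) (a : state_var n) : var := inl (a, t).
Definition aux_var (t : 'I_m) (i : aux (tnth C t)) : var :=
  inr (Tagged (fun t => aux (tnth C t)) i).

Definition initial_formula (P : pauli_string n) : formula var :=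
  FAnd (pauli_formula id (at_time ord0) P) (FLit (at_time ord0 sr) false).

Definition final_formula (P : pauli_string n) : formula var :=
  pauli_formula id (at_time ord_max) P.

Definition step_formula (t : 'I_m) : formula var :=
  gate_formula (at_time (widen_ord (leqnSn m) t)) (at_time (lift ord0 t))
               (aux_var (t := t)).

Definition circuit_formula (P : pauli_string n) : formula var :=
  FAnd (initial_formula P) (\FAnd_(t in 'I_m) step_formula t).

Definition weight (v : var) (b : bool) : R :=
  match v with
  | inl (a, t) => if [&& a == sr, t == ord_max & b] then - 1 else 1
  | inr (existT t i) => if b then aux_weight i else 1
  end.

End Circuit.

(* Main.v *)
Require Import Defs.
From mathcomp Require Import all_boot all_order all_algebra.
From mathcomp Require Import complex reals trigo ring lra.

(* Expand the operator Q |-> U Q U^dagger of every gate in the Pauli basis: the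
   Pauli coefficient of Q' in U Q U^dagger is a signed weight, which is exactly
   what the constraint and the auxiliary weights of the gate encode.  An
   assignment that satisfies the circuit formula is a path of signed Pauli
   strings, its auxiliary variables being determined by the path, and so the
   model count is the sum over paths of the products of these coefficients,
   i.e. a product of transfer matrices.  Since conjugation by A is the composite
   of the conjugations by the gates, that product is the coefficient sought.

   To compute the coefficients, each gate is written as a combination of two
   Kronecker products that are the identity away from its qubits: H as a sum of
   X and Z, S and T by the projections on |0> and |1>, R_X by 1 and X, CZ as
   1 - 2 D (x) D and Toffoli as 1 - D (x) D (x) (1 - X), with D = |1><1|.  The
   coefficients then factor over the qubits into traces of 2 x 2 matrices. *)

Set Implicit Arguments.
Unset Strict Implicit.
Unset Printing Implicit Defensive.

Import Order.TTheory GRing.Theory Num.Theory.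

Local Open Scope ring_scope.
Local Open Scope complex_scope.

(** * Kronecker products and the Pauli basis *)

Lemma conj_conjc (R : rcfType) (x : R[i]) : Num.conj x = conjc x.
Proof. by []. Qed.

(** * Binary digits of basis states *)

Section Digits.

Variable n : nat.

Definition digits (a : 'I_(2 ^ n)) : {ffun 'I_n -> 'I_2} :=
  [ffun j => inord (qbit a j)].

(** Induction on the number [k] of leading qubits: [a %/ 2 ^ (n - k)] is the number that they spell,
    and [k = n] gives [a] itself. *)
Lemma qbit_inj (a b : 'I_(2 ^ n)) : qbit a =1 qbit b -> a = b.
Proof.
move=> ab; suff H k : (k <= n)%N -> (a %/ 2 ^ (n - k) = b %/ 2 ^ (n - k))%N.
  by apply: val_inj; have /= := H n (leqnn n); rewrite subnn !divn1.
elim: k => [|k IHk] lkn; first by rewrite subn0 !divn_small.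
have /IHk {}IHk := ltnW lkn.
have Hd c : (c %/ 2 ^ (n - k.+1) =
    odd (c %/ 2 ^ (n - k.+1)) + (c %/ 2 ^ (n - k)).*2)%N.
  rewrite -[LHS]odd_double_half; congr (_ + _.*2)%N.
  by rewrite -divn2 -divnMA -expnSr subnSK.
by rewrite Hd [RHS]Hd IHk; have := ab (Ordinal lkn); rewrite /qbit /= => ->.
Qed.

Lemma inord_bool_inj : injective (fun b : bool => inord b : 'I_2).
Proof. by move=> b c /(congr1 val); rewrite /= !inordK; case: b; case: c. Qed.

Lemma digits_inj : injective digits.
Proof.
move=> a b /ffunP ab; apply: qbit_inj => j.
by have := ab j; rewrite !ffunE => /inord_bool_inj.
Qed.

Lemma digits_bij : bijective digits.
Proof.
apply: inj_card_bij; first exact: digits_inj.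
by rewrite card_ffun !card_ord.
Qed.

(** Distributivity along the bijection between basis states and digit strings; products and traces
    of Kronecker products factor over the qubits because of it. *)
Lemma sum_digits (K : comPzRingType) (F : 'I_n -> 'I_2 -> K) :
  \sum_(a : 'I_(2 ^ n)) \prod_j F j (inord (qbit a j)) =
  \prod_j \sum_i F j i.
Proof.
rewrite bigA_distr_bigA /= (reindex digits); last exact: onW_bij digits_bij.
by apply: eq_bigr => a _; apply: eq_bigr => j _; rewrite ffunE.
Qed.

End Digits.

Lemma prodr_natb (K : comPzRingType) (I : finType) (A B : pred I) :
  \prod_(i | A i) (B i)%:R = [forall i, A i ==> B i]%:R :> K.
Proof.
rewrite -natr_prod -big_andE; congr _%:R.
have andM b c : (b && c : nat) = (b * c)%N by rewrite mulnb.
by rewrite (big_morph nat_of_bool (id1 := 1%N) (op1 := muln) andM).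
Qed.

(** * Algebra of Kronecker products *)

Section TensorTheory.

Variables (n : nat).

Lemma eq_tensor (K : comPzRingType) (M N : 'I_n -> 'M[K]_2) :
  M =1 N -> tensor M = tensor N.
Proof.
move=> MN; apply/matrixP => a b; rewrite !tensorE.
by apply: eq_bigr => j _; rewrite MN.
Qed.

Lemma tensor_mul (K : comPzRingType) (M N : 'I_n -> 'M[K]_2) :
  tensor M *m tensor N = tensor (fun j => M j *m N j).
Proof.
apply/matrixP => a b; rewrite mxE tensorE.
under eq_bigr => c _ do rewrite !tensorE -big_split /=.
rewrite (sum_digits (fun j i =>
  M j (inord (qbit a j)) i * N j i (inord (qbit b j)))).
by apply: eq_bigr => j _; rewrite mxE.
Qed.

Lemma tensor_tr (K : comPzRingType) (M : 'I_n -> 'M[K]_2) :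
  \tr (tensor M) = \prod_j \tr (M j).
Proof.
rewrite -(sum_digits (fun j i => M j i i)).
by apply: eq_bigr => a _; rewrite tensorE.
Qed.

Lemma tensor_dagger (R : rcfType) (M : 'I_n -> 'M[R[i]]_2) :
  dagger (tensor M) = tensor (fun j => dagger (M j)).
Proof.
apply/matrixP => a b; rewrite !mxE !tensorE rmorph_prod.
by apply: eq_bigr => j _; rewrite !mxE.
Qed.

Lemma prod_digits_eq (K : comPzRingType) (a b : 'I_(2 ^ n)) :
  \prod_j (inord (qbit a j) == inord (qbit b j) :> 'I_2)%:R = (a == b)%:R :> K.
Proof.
rewrite prodr_natb; congr ((nat_of_bool _)%:R).
apply/forallP/eqP => [ab|-> j]; last exact/eqP.
by apply: qbit_inj => j; apply/inord_bool_inj/eqP/ab.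
Qed.

Lemma tensor1E (K : comPzRingType) :
  tensor (fun _ : 'I_n => 1%:M) = 1%:M :> 'M[K]_(2 ^ n).
Proof.
apply/matrixP => a b; rewrite tensorE mxE -prod_digits_eq.
by apply: eq_bigr => j _; rewrite mxE.
Qed.

End TensorTheory.

Section Dagger.

Variable R : rcfType.

Lemma daggerM (p q s : nat) (M : 'M[R[i]]_(p, q)) (N : 'M_(q, s)) :
  dagger (M *m N) = dagger N *m dagger M.
Proof. by rewrite /dagger map_mxM trmx_mul. Qed.

Lemma dagger_sumZ (I : finType) (p q : nat) (u : I -> R[i])
    (M : I -> 'M[R[i]]_(p, q)) :
  dagger (\sum_i u i *: M i) = \sum_i Num.conj (u i) *: dagger (M i).
Proof.
apply/matrixP => a b; rewrite !mxE !summxE rmorph_sum /=.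
by apply: eq_bigr => i _; rewrite !mxE rmorphM.
Qed.

Lemma dagger1 p : dagger 1%:M = 1%:M :> 'M[R[i]]_p.
Proof. by rewrite /dagger map_mx1 trmx1. Qed.

End Dagger.

(** * Orthogonality, completeness and expansion in the Pauli basis *)

Section PauliBasis.

Variable R : rcfType.

Lemma sum_pair_bool (V : nmodType) (F : bool * bool -> V) :
  \sum_p F p =
  F (true, true) + F (true, false) + F (false, true) + F (false, false).
Proof.
transitivity (\sum_(a : bool) \sum_(b : bool) F (a, b)).
  by rewrite pair_bigA; apply: eq_bigr => -[].
by rewrite !big_bool /= !addrA.
Qed.

Lemma mxtrace2 (K : pzRingType) (M : 'M[K]_2) : \tr M = M 0 0 + M 1 1.
Proof.
rewrite /mxtrace !big_ord_recl big_ord0 addr0.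
by congr (_ + M _ _); apply: val_inj.
Qed.

(* Matrices with Gaussian integer entries, as boolean-indexed functions: their
   products and traces evaluate by computation, so that finite case analyses
   can be decided there.  mulc multiplies Gaussian integers because int[i] has
   no ring structure in the library. *)
Definition gauss (z : int[i]) : R[i] := let: a +i* b := z in a%:~R +i* b%:~R.

Lemma gauss_add : {morph gauss : x y / x + y}.
Proof.
by move=> [a b] [c d]; apply/eqP; rewrite eq_complex /= !rmorphD !eqxx.
Qed.

Lemma gauss_mul : {morph gauss : x y / mulc x y >-> x * y}.
Proof.
move=> [a b] [c d]; apply/eqP.
by rewrite eq_complex /= !(rmorphB, rmorphD, rmorphM) !eqxx.
Qed.

Lemma gauss_conj : {morph gauss : x / conjc x >-> Num.conj x}.
Proof. by move=> [a b]; apply/eqP; rewrite eq_complex /= rmorphN !eqxx. Qed.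

Definition gmx (A : bool -> bool -> int[i]) : 'M[R[i]]_2 :=
  \matrix_(i, j) gauss (A (i != 0) (j != 0)).

Definition gdagger (A : bool -> bool -> int[i]) a b := conjc (A b a).
Definition gmul (A B : bool -> bool -> int[i]) a b :=
  mulc (A a false) (B false b) + mulc (A a true) (B true b).
Definition gtrace (A : bool -> bool -> int[i]) := A false false + A true true.

Lemma gmx_dagger A : dagger (gmx A) = gmx (gdagger A).
Proof. by apply/matrixP => i j; rewrite !mxE gauss_conj. Qed.

Lemma gmx_mul A B : gmx A *m gmx B = gmx (gmul A B).
Proof.
apply/matrixP => i j; rewrite !mxE !big_ord_recl big_ord0 addr0 !mxE /=.
by rewrite -!gauss_mul -gauss_add.
Qed.

Lemma gmx_trace A : \tr (gmx A) = gauss (gtrace A).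
Proof. by rewrite mxtrace2 !mxE -gauss_add. Qed.

Definition gint (k : int) : int[i] := k +i* 0.

Definition gsigma (p : bool * bool) (i j : bool) : int[i] :=
  match p with
  | (false, false) => if i == j then gint 1 else gint 0
  | (false, true) => if i == j then (if i then gint (-1) else gint 1) else gint 0
  | (true, false) => if i == j then gint 0 else gint 1
  | (true, true) => if i == j then gint 0 else if i then 0 +i* 1 else 0 +i* -1
  end.

Lemma sigma_gmx p : sigma R p = gmx (gsigma p).
Proof.
apply/matrixP => i j; case: p => -[] []; rewrite !mxE.
all: case: (i == 0); case: (j == 0) => /=.
all: by apply/eqP; rewrite eq_complex /= ?(rmorphN, oppr0) ?rmorph1 !eqxx.
Qed.

Lemma gauss_int (k : int) : gauss (gint k) = k%:~R.
Proof. by rewrite -(rmorph_int (@real_complex R)). Qed.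

Lemma sigma_orthogonal (p q : bool * bool) :
  \tr (dagger (sigma R p) *m sigma R q) = (p == q)%:R *+ 2.
Proof.
rewrite !sigma_gmx gmx_dagger gmx_mul gmx_trace -mulrnA pmulrn -gauss_int.
(* Both sides are now images of Gaussian integers, so the equation moves to [int[i]], where the
   sixteen label pairs evaluate. *)
congr gauss.
by case: p q => [[] []] [[] []]; vm_compute.
Qed.

(** The one-qubit completeness relation, dual to orthogonality; its tensor power shows that Pauli
    strings span all matrices. *)
Lemma sigma_complete (a b c d : 'I_2) :
  \sum_p (sigma R p) a b * Num.conj (sigma R p c d) =
  (a == c)%:R * (b == d)%:R * 2.
Proof.
have neq0_inj : injective (fun i : 'I_2 => i != 0).
  by case=> [[|[]]//= ?] [[|[]]//= ?] // _; apply: val_inj.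
have -> : (a == c) = ((a != 0) == (c != 0)) by rewrite (inj_eq neq0_inj).
have -> : (b == d) = ((b != 0) == (d != 0)) by rewrite (inj_eq neq0_inj).
rewrite sum_pair_bool !sigma_gmx !mxE -!gauss_conj -!gauss_mul -!gauss_add.
rewrite -!natrM pmulrn -gauss_int; congr gauss.
by case: (a != 0); case: (b != 0); case: (c != 0); case: (d != 0); vm_compute.
Qed.

Variable n : nat.

Definition pauli_coef (M : 'M[R[i]]_(2 ^ n)) (P : pauli_string n) : R[i] :=
  (2 ^ n)%:R^-1 * \tr (dagger (pauli_mx R P) *m M).

Lemma pow2n_neq0 : (2 ^ n)%:R != 0 :> R[i].
Proof. by rewrite pnatr_eq0 -lt0n expn_gt0. Qed.

Lemma pauli_coef_basis (P Q : pauli_string n) :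
  pauli_coef (pauli_mx R Q) P = (P == Q)%:R.
Proof.
rewrite /pauli_coef tensor_dagger tensor_mul tensor_tr.
under eq_bigr do rewrite sigma_orthogonal -mulr_natr.
rewrite big_split /= prodr_const card_ord -natrX mulrC mulfK ?pow2n_neq0 //.
rewrite prodr_natb; congr ((nat_of_bool _)%:R).
apply/forallP/eqP => [QP|-> j]; last exact/eqP.
by apply/ffunP => j; apply/eqP/QP.
Qed.

Lemma pauli_expansion (M : 'M[R[i]]_(2 ^ n)) :
  M = \sum_P pauli_coef M P *: pauli_mx R P.
Proof.
apply/matrixP => a b; rewrite summxE.
have complete c d : \sum_P pauli_mx R P a b * Num.conj (pauli_mx R P c d) =
    (a == c)%:R * (b == d)%:R * (2 ^ n)%:R.
  under eq_bigr => P _ do rewrite !tensorE rmorph_prod -big_split /=.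
  (* A Pauli string is a choice of one label per qubit, so the sum over strings is a product of
     one-qubit sums. *)
  rewrite -(bigA_distr_bigA (fun j p =>
    sigma R p _ _ * Num.conj (sigma R p _ _))) /=.
  under eq_bigr => j _ do rewrite sigma_complete.
  by rewrite !big_split /= prodr_const card_ord -natrX !prod_digits_eq.
(* The entry of [M] is written against Kronecker deltas, which [complete] then turns into sums over
   Pauli strings. *)
transitivity (\sum_c \sum_d M c d * ((a == c)%:R * (b == d)%:R)).
  rewrite (bigD1 a) //= (bigD1 b) //= !eqxx !mulr1 big1 ?addr0 =>
    [|d /negbTE bd].
    rewrite big1 ?addr0 // => c /negbTE ac.
    by rewrite big1 // => d _; rewrite eq_sym ac mul0r mulr0.
  by rewrite eq_sym bd !mulr0.
under [RHS]eq_bigr => P _ do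
  rewrite mxE /pauli_coef -mulrA mulr_suml /mxtrace mulr_sumr.
rewrite [RHS]exchange_big [LHS]exchange_big /=; apply: eq_bigr => d _.
under [RHS]eq_bigr => P _ do rewrite mxE mulr_suml mulr_sumr.
rewrite [RHS]exchange_big /=; apply: eq_bigr => c _.
rewrite -[X in M c d * X](mulfK pow2n_neq0) -complete mulr_suml mulr_sumr.
by apply: eq_bigr => P _; rewrite !mxE; ring.
Qed.

Lemma pauli_coef_sum (I : finType) (u : I -> R[i])
    (M : I -> 'M[R[i]]_(2 ^ n)) P :
  pauli_coef (\sum_i u i *: M i) P = \sum_i u i * pauli_coef (M i) P.
Proof.
rewrite /pauli_coef mulmx_sumr raddf_sum mulr_sumr; apply: eq_bigr => i _.
by rewrite -scalemxAr /= mxtraceZ mulrCA.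
Qed.

(** Two operators are allowed because conjugation by a sum of Kronecker products produces cross
    terms. *)
Definition local_coef (A B : 'M[R[i]]_2) (p q : bool * bool) : R[i] :=
  2^-1 * \tr (dagger (sigma R q) *m (A *m sigma R p *m dagger B)).

Lemma local_coef1 p q : local_coef 1%:M 1%:M p q = (q == p)%:R.
Proof.
rewrite /local_coef dagger1 mul1mx mulmx1 sigma_orthogonal.
by rewrite -[X in _ * X]mulr_natl mulKf // pnatr_eq0.
Qed.

Lemma pauli_coef_tensor (M N : 'I_n -> 'M[R[i]]_2) (P Q : pauli_string n) :
  pauli_coef (tensor M *m pauli_mx R P *m dagger (tensor N)) Q =
  \prod_j local_coef (M j) (N j) (P j) (Q j).
Proof.
rewrite /pauli_coef !tensor_dagger !tensor_mul tensor_tr big_split /=.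
by rewrite prodr_const card_ord natrX exprVn.
Qed.

(** Expand [U] and its adjoint bilinearly. Off [t] both factors are the identity, whose local
    coefficient is a Kronecker delta, and this yields the frame indicator common to all terms. *)
Lemma pauli_coef_sum_tensor (t : seq 'I_n) (S : finType)
    (u : S -> R[i]) (M : S -> 'I_n -> 'M[R[i]]_2) (U : 'M_(2 ^ n))
    (P Q : pauli_string n) :
  uniq t -> U = \sum_s u s *: tensor (M s) ->
  (forall s k, k \notin t -> M s k = 1%:M) ->
  pauli_coef (U *m pauli_mx R P *m dagger U) Q =
  [forall k, (k \notin t) ==> (Q k == P k)]%:R *
  \sum_s \sum_s' u s * Num.conj (u s') *
    \prod_(k <- t) local_coef (M s k) (M s' k) (P k) (Q k).
Proof.
move=> t_uniq -> M1.
rewrite dagger_sumZ -mulmxA mulmx_suml.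
under eq_bigr => s _ do rewrite -scalemxAl.
rewrite pauli_coef_sum mulr_sumr; apply: eq_bigr => s _.
rewrite !mulmx_sumr; under eq_bigr => s' _ do rewrite -!scalemxAr.
rewrite pauli_coef_sum !mulr_sumr; apply: eq_bigr => s' _.
rewrite mulmxA pauli_coef_tensor (bigID (fun k => k \in t)) /=.
rewrite [X in u s * (_ * (_ * X))](_ : _ =
  [forall k, (k \notin t) ==> (Q k == P k)]%:R); last first.
  rewrite -prodr_natb.
  by apply: eq_bigr => k tk; rewrite !M1 // local_coef1.
by rewrite -big_uniq //=; ring.
Qed.

End PauliBasis.

(** * Pauli coefficients of the gates *)

Section Local.
Variable R : rcfType.

Definition g1 (a b : bool) : int[i] := gint (a == b)%:Z.
Definition gproj (c a b : bool) : int[i] := gint ((a == b) && (a == c))%:Z.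
Definition gX (a b : bool) : int[i] := gint (a != b)%:Z.
(* 1 - X *)
Definition g1X (a b : bool) : int[i] := gint (if a == b then 1 else -1).

(** The factor 1/2 of [local_coef] is left out so that the value stays a Gaussian integer. *)
Definition glocal_coef (A B : bool -> bool -> int[i]) (p q : bool * bool) :=
  gtrace (gmul (gdagger (gsigma q)) (gmul (gmul A (gsigma p)) (gdagger B))).

Lemma local_coef_gmx A B p q :
  local_coef (gmx R A) (gmx R B) p q = 2^-1 * gauss R (glocal_coef A B p q).
Proof. by rewrite /local_coef !sigma_gmx !(gmx_dagger, gmx_mul) gmx_trace. Qed.

Lemma gmx_g1 : gmx R g1 = 1%:M.
Proof.
apply/matrixP => i j; rewrite !mxE gauss_int.
by case: i j => [[|[]]//= ?] [[|[]]//= ?].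
Qed.

Lemma on_qubit_sum (n : nat) (u v : R[i]) (M N : 'M[R[i]]_2) (j : 'I_n) :
  on_qubit (u *: M + v *: N) j = u *: on_qubit M j + v *: on_qubit N j.
Proof.
apply/matrixP => a b; rewrite !mxE !tensorE.
rewrite (bigD1 j) //= [in X in _ = u * X + _](bigD1 j) //=.
rewrite [in X in _ = _ + v * X](bigD1 j) //=.
rewrite eqxx !mxE mulrDl !mulrA; congr (_ * _ + _ * _).
all: by apply: eq_bigr => k /negbTE ->.
Qed.

(** Irrational or parametrised entries are confined to [u] and [v]; the four remaining traces can be
    computed. *)
Lemma pauli_coef_on_qubit (n : nat) (U : 'M[R[i]]_2) (u v : R[i]) A B
    (j : 'I_n) (P Q : pauli_string n) :
  U = u *: gmx R A + v *: gmx R B ->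
  pauli_coef (on_qubit U j *m pauli_mx R P *m dagger (on_qubit U j)) Q =
  [forall k, (k \notin [:: j]) ==> (Q k == P k)]%:R *
  (2^-1 * (u * Num.conj u * gauss R (glocal_coef A A (P j) (Q j)) +
   u * Num.conj v * gauss R (glocal_coef A B (P j) (Q j)) +
   v * Num.conj u * gauss R (glocal_coef B A (P j) (Q j)) +
   v * Num.conj v * gauss R (glocal_coef B B (P j) (Q j)))).
Proof.
move=> ->.
rewrite (@pauli_coef_sum_tensor _ _ [:: j] bool (fun s => if s then u else v)
  (fun s k => if k == j then (if s then gmx R A else gmx R B) else 1%:M)) //; first last.
- by move=> s k; rewrite inE => /negbTE ->.
- by rewrite on_qubit_sum big_bool.
congr (_ * _).
have term s s' : \prod_(k <- [:: j])
    local_coef (if k == j then (if s then gmx R A else gmx R B) else 1%:M)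
      (if k == j then (if s' then gmx R A else gmx R B) else 1%:M) (P k) (Q k) =
    2^-1 * gauss R (glocal_coef (if s then A else B) (if s' then A else B)
                      (P j) (Q j)).
  by rewrite big_seq1 eqxx -!(fun_if (gmx R)) local_coef_gmx.
under eq_bigr => s _ do under eq_bigr => s' _ do rewrite term.
by rewrite !big_bool /=; ring.
Qed.

Lemma qbit_eqE (n : nat) (a b : 'I_(2 ^ n)) :
  (a == b) = [forall j, qbit a j == qbit b j].
Proof.
apply/eqP/forallP => [-> j //|ab]; apply: qbit_inj => j; exact/eqP.
Qed.

Lemma inord_bool_neq0 (b : bool) : (inord b != 0 :> 'I_2) = b.
Proof. by rewrite -val_eqE /= inordK; case: b. Qed.

Lemma gmx_gprojE (c x y : bool) :
  gmx R (gproj c) (inord x) (inord y) = ((x == y) && (x == c))%:R.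
Proof. by rewrite mxE gauss_int !inord_bool_neq0. Qed.

Lemma gmx_g1XE (x y : bool) :
  gmx R g1X (inord x) (inord y) = if x == y then 1 else -1.
Proof.
by rewrite mxE gauss_int !inord_bool_neq0; case: (x == y); rewrite ?rmorphN.
Qed.

Lemma id_mxE (x y : bool) :
  (1%:M : 'M[R[i]]_2) (inord x) (inord y) = (x == y)%:R.
Proof. by rewrite mxE (inj_eq inord_bool_inj). Qed.

(** Here [s = true] indexes the identity and [s = false] the product of projections; a diagonal
    entry becomes 1 - 2 = -1 exactly when both qubits are 1. *)
Lemma cz_mx_sum (n : nat) (j k : 'I_n) :
  cz_mx R[i] j k = \sum_(s : bool) (if s then 1 else -2) *:
    tensor (fun q => if ~~ s && (q \in [:: j; k]) then gmx R (gproj true)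
                     else 1%:M).
Proof.
rewrite big_bool /= tensor1E; apply/matrixP => a b.
rewrite !mxE tensorE.
have -> : \prod_(q < n) (if q \in [:: j; k] then gmx R (gproj true) else 1%:M)
      (inord (qbit a q)) (inord (qbit b q)) =
    ((a == b) && (qbit a j && qbit a k))%:R.
  transitivity (\prod_(q < n)
      ((qbit a q == qbit b q) && ((q \in [:: j; k]) ==> qbit a q))%:R : R[i]).
    apply: eq_bigr => q _; case: ifP => _; last by rewrite id_mxE andbT.
    by rewrite gmx_gprojE eqb_id.
  rewrite prodr_natb qbit_eqE; congr ((nat_of_bool _)%:R).
  apply/forallP/andP => /= [ab|[/forallP ab /andP[aj ak]] q].
    split; first by apply/forallP => q; have /andP[] := ab q.
    have /andP[_] := ab j; have /andP[_] := ab k.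
    by rewrite !inE !eqxx orbT /= => -> ->.
  by rewrite ab /= !inE; apply/implyP => /orP[] /eqP ->.
by case: (a == b); case: (qbit a j && qbit a k) => /=; ring.
Qed.

Lemma toffoli_mx_sum (n : nat) (j k l : 'I_n) : uniq [:: j; k; l] ->
  toffoli_mx R[i] j k l = \sum_(s : bool) (if s then 1 else -1) *:
    tensor (fun q => if ~~ s && (q \in [:: j; k; l]) then
                       (if q == l then gmx R g1X else gmx R (gproj true))
                     else 1%:M).
Proof.
rewrite /= !inE negb_or andbT => /andP[/andP[_ jl] kl].
rewrite big_bool /= tensor1E; apply/matrixP => a b.
rewrite !mxE tensorE.
have split_l (F : pred 'I_n) :
    [forall q, F q] = F l && [forall q, (q != l) ==> F q].
  apply/forallP/andP => [Fq|[Fl /forallP Fq] q].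
    by split=> //; apply/forallP => q; apply/implyP.
  by have [->|ql] := eqVneq q l => //; have := Fq q; rewrite ql.
(* The target is split off: its factor [1 - X] is the only one that is not diagonal. *)
rewrite (bigD1 l) //= !inE eqxx !orbT gmx_g1XE.
have -> : \prod_(q < n | q != l)
    (if q \in [:: j; k; l] then
       (if q == l then gmx R g1X else gmx R (gproj true))
     else 1%:M) (inord (qbit a q)) (inord (qbit b q)) =
    ([forall q, (q != l) ==> (qbit a q == qbit b q)] &&
     (qbit b j && qbit b k))%:R.
  transitivity (\prod_(q < n | q != l)
      ((qbit a q == qbit b q) && ((q \in [:: j; k]) ==> qbit b q))%:R : R[i]).
    apply: eq_bigr => q /negbTE ql; rewrite !inE ql orbF.
    case: ifP => _; last by rewrite id_mxE andbT.
    by rewrite gmx_gprojE eqb_id; case: (qbit a q); case: (qbit b q).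
  rewrite prodr_natb; congr ((nat_of_bool _)%:R).
  apply/forallP/andP => /= [ab|[/forallP ab /andP[bj bk]] q].
    split.
      apply/forallP => q; apply/implyP => ql.
      by have /implyP/(_ ql)/andP[] := ab q.
    have /implyP/(_ jl)/andP[_] := ab j; have /implyP/(_ kl)/andP[_] := ab k.
    by rewrite !inE !eqxx orbT /= => -> ->.
  apply/implyP => ql; have /implyP/(_ ql) -> /= := ab q.
  by rewrite !inE; apply/implyP => /orP[] /eqP ->.
(* With agreement off the target abstracted as [E], only the two target bits and the conjunction of
   the controls matter. *)
set E := [forall q, (q != l) ==> (qbit a q == qbit b q)].
have -> : (a == b) = (qbit a l == qbit b l) && E by rewrite qbit_eqE split_l.
have -> : [forall q, qbit a q
      == (if q == l then qbit b q (+) (qbit b j && qbit b k) else qbit b q)] =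
    (qbit a l == qbit b l (+) (qbit b j && qbit b k)) && E.
  rewrite split_l eqxx; congr (_ && _).
  by apply: eq_forallb => q; case: (q == l).
case: E; rewrite /= ?andbF ?andbT;
  case: (qbit a l); case: (qbit b l); case: (qbit b j && qbit b k) => /=.
all: ring.
Qed.

End Local.

(* The traces that one qubit contributes to U P U^dagger when U is
   1 + c A (x) B (x) ..., one for each choice of a term of U and one of
   U^dagger; gconj_coef multiplies them over the qubits. *)
Definition glocal_coefs (A : bool -> bool -> int[i]) p q :
  (int[i] * int[i]) * (int[i] * int[i]) :=
  ((glocal_coef g1 g1 p q, glocal_coef g1 A p q),
   (glocal_coef A g1 p q, glocal_coef A A p q)).

Definition gprod (V : Type) (f : V -> int[i]) (L : seq V) : int[i] :=
  foldr (fun x => mulc (f x)) (gint 1) L.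

Definition gconj_coef (c : int)
    (L : seq ((int[i] * int[i]) * (int[i] * int[i]))) : int[i] :=
  gprod (fun x => x.1.1) L + mulc (gint c) (gprod (fun x => x.1.2) L) +
  mulc (gint c) (gprod (fun x => x.2.1) L) +
  mulc (gint (c * c)) (gprod (fun x => x.2.2) L).

Section TwoTerms.
Variable R : rcfType.

(** The halves of all touched qubits are collected in front, so that what remains is one computable
    Gaussian integer. *)
Lemma pauli_coef_one_plus_tensor (n : nat) (t : seq 'I_n) (c : int)
    (A : 'I_n -> bool -> bool -> int[i]) (U : 'M[R[i]]_(2 ^ n))
    (P Q : pauli_string n) :
  uniq t ->
  U = \sum_(s : bool) (if s then 1 else c%:~R) *:
    tensor (fun q => if ~~ s && (q \in t) then gmx R (A q) else 1%:M) ->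
  pauli_coef (U *m pauli_mx R P *m dagger U) Q =
  [forall k, (k \notin t) ==> (Q k == P k)]%:R *
  (2 ^- size t *
   gauss R (gconj_coef c [seq glocal_coefs (A k) (P k) (Q k) | k <- t])).
Proof.
move=> t_uniq U_sum; rewrite (pauli_coef_sum_tensor _ _ t_uniq U_sum); last first.
  by move=> s k /negbTE ->; rewrite andbF.
congr (_ * _).
have term s s' : \prod_(k <- t)
    local_coef (if ~~ s && (k \in t) then gmx R (A k) else 1%:M)
      (if ~~ s' && (k \in t) then gmx R (A k) else 1%:M) (P k) (Q k) =
    2 ^- size t * gauss R (gprod (fun x => let y := if s then x.1 else x.2 in
      if s' then y.1 else y.2) [seq glocal_coefs (A k) (P k) (Q k) | k <- t]).
  rewrite big_seq; under eq_bigr => k -> do rewrite !andbT.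
  rewrite -big_seq; elim: t {t_uniq U_sum} => [|k t IHt].
    by rewrite big_nil gauss_int expr0 invr1 mul1r.
  rewrite big_cons IHt /= gauss_mul exprS invfM.
  have gmx_if b :
      (if ~~ b then gmx R (A k) else 1%:M) = gmx R (if b then g1 else A k).
    by case: b; rewrite //= gmx_g1.
  rewrite !gmx_if local_coef_gmx.
  by case: s s' {IHt gmx_if} => [] []; rewrite /=; ring.
have conj_c : Num.conj (c%:~R : R[i]) = c%:~R by rewrite rmorph_int.
under eq_bigr => s _ do under eq_bigr => s' _ do rewrite term.
rewrite !big_bool /= conj_c !rmorph1 !gauss_add !gauss_mul !gauss_int intrM.
ring.
Qed.

Lemma pauli_coef_cz (n : nat) (j k : 'I_n) (P Q : pauli_string n) : j != k ->
  pauli_coef (cz_mx R[i] j k *m pauli_mx R P *m dagger (cz_mx R[i] j k)) Q =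
  [forall i, (i \notin [:: j; k]) ==> (Q i == P i)]%:R *
  (4^-1 * gauss R (gconj_coef (-2)
    [:: glocal_coefs (gproj true) (P j) (Q j);
        glocal_coefs (gproj true) (P k) (Q k)])).
Proof.
move=> jk.
rewrite (@pauli_coef_one_plus_tensor _ [:: j; k] (-2) (fun=> gproj true)) //=.
- by congr (_ * (_ * _)); congr _^-1; ring.
- by rewrite inE jk.
- by rewrite cz_mx_sum; apply: eq_bigr => -[] //= _; rewrite rmorphN.
Qed.

Lemma pauli_coef_toffoli (n : nat) (j k l : 'I_n) (P Q : pauli_string n) :
  uniq [:: j; k; l] ->
  pauli_coef (toffoli_mx R[i] j k l *m pauli_mx R P *m
              dagger (toffoli_mx R[i] j k l)) Q =
  [forall i, (i \notin [:: j; k; l]) ==> (Q i == P i)]%:R *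
  (8^-1 * gauss R (gconj_coef (-1)
    [:: glocal_coefs (gproj true) (P j) (Q j);
        glocal_coefs (gproj true) (P k) (Q k);
        glocal_coefs g1X (P l) (Q l)])).
Proof.
move=> jkl; rewrite (@pauli_coef_one_plus_tensor _ [:: j; k; l] (-1)
  (fun q => if q == l then g1X else gproj true)) //=.
- move: jkl; rewrite /= !inE negb_or.
  move=> /and3P[/andP[_ /negbTE jl] /negbTE kl _].
  by rewrite eqxx jl kl; congr (_ * (_ * _)); congr _^-1; ring.
- rewrite toffoli_mx_sum //; apply: eq_bigr => -[] _ /=; rewrite ?rmorphN //.
  by congr (_ *: _); apply: eq_tensor => q; do 2 case: ifP => //.
Qed.

(** Reconciles [toffoli_coef], which traces against [Q] itself, with [pauli_coef], which uses the
    adjoint. *)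
Lemma pauli_hermitian n (P : pauli_string n) :
  dagger (pauli_mx R P) = pauli_mx R P.
Proof.
rewrite /pauli_mx tensor_dagger; apply: eq_tensor => j.
rewrite !sigma_gmx gmx_dagger; apply/matrixP => a b; rewrite !mxE; congr gauss.
by case: (P j) => -[] []; case: (a != 0); case: (b != 0); vm_compute.
Qed.

Lemma toffoli_coefE (P Q : pauli_string 3) : toffoli_coef R P Q =
  8^-1 * gauss R (gconj_coef (-1)
    [:: glocal_coefs (gproj true) (P (inord 0)) (Q (inord 0));
        glocal_coefs (gproj true) (P (inord 1)) (Q (inord 1));
        glocal_coefs g1X (P (inord 2)) (Q (inord 2))]).
Proof.
have uniq3 : uniq [:: inord 0; inord 1; inord 2 : 'I_3].
  by rewrite /= !inE -!val_eqE /= !inordK.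
have := pauli_coef_toffoli P Q uniq3.
rewrite (_ : [forall i, _] = true) ?mul1r; last first.
  apply/forallP => -[[|[|[|//]]] lti]; rewrite !inE -!val_eqE /= !inordK //.
move=> <-; rewrite /pauli_coef pauli_hermitian; congr (_^-1 * _); ring.
Qed.

Definition bool_pairs : seq (bool * bool) :=
  [:: (false, false); (false, true); (true, false); (true, true)].

(* Only a few values remain after [undup], which keeps the enumeration in
   gconj_toffoli_values far below the 4 ^ 6 cases for the labels. *)
Lemma glocal_coefs_mem A p q :
  glocal_coefs A p q \in
  undup [seq glocal_coefs A p' q' | p' <- bool_pairs, q' <- bool_pairs].
Proof.
by rewrite mem_undup; apply: allpairs_f; [case: p | case: q] => -[] [].
Qed.

(** This integer is eight times the Toffoli coefficient, which is therefore 0, 1/2, -1/2, 1 or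
    -1. *)
Lemma gconj_toffoli_values p1 p2 p3 q1 q2 q3 :
  gconj_coef (-1) [:: glocal_coefs (gproj true) p1 q1;
                      glocal_coefs (gproj true) p2 q2;
                      glocal_coefs g1X p3 q3]
  \in [:: gint 0; gint 4; gint (-4); gint 8; gint (-8)].
Proof.
have := glocal_coefs_mem g1X p3 q3; have := glocal_coefs_mem (gproj true) p2 q2.
have := glocal_coefs_mem (gproj true) p1 q1.
set sE := undup _; set sX := undup _ => v1 v2 v3.
have /allP/(_ _ v1)/allP/(_ _ v2)/allP/(_ _ v3) // :
    all (fun v1 => all (fun v2 => all (fun v3 => gconj_coef (-1) [:: v1; v2; v3]
      \in [:: gint 0; gint 4; gint (-4); gint 8; gint (-8)]) sX) sE) sE.
by vm_compute.
Qed.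

(** CZ is a Clifford gate, so each string has a single signed image; the 4 cancels the normalisation
    in [pauli_coef_cz]. *)
Lemma gconj_czE p1 p2 q1 q2 :
  gconj_coef (-2) [:: glocal_coefs (gproj true) p1 q1;
                      glocal_coefs (gproj true) p2 q2] =
  gint (4 * ([&& q1 == (p1.1, p1.2 (+) p2.1) & q2 == (p2.1, p2.2 (+) p1.1)]%:Z *
             (-1) ^+ (p1.1 && p2.1 && (p2.2 (+) p1.2)))).
Proof.
by case: p1 p2 q1 q2 => [[] []] [[] []] [[] []] [[] []]; vm_compute.
Qed.

(** Each of the five possible values splits into support, sign and modulus: what the constraint, the
    bit [r] and the weight of [u] record. *)
Lemma toffoli_coef_weight (P Q : pauli_string 3) (c := toffoli_coef R P Q) :
  c = (c != 0)%:R * (-1) ^+ (c < 0)%R * (if `|c| == 2^-1 then 2^-1 else 1).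
Proof.
rewrite /c toffoli_coefE.
have := gconj_toffoli_values (P (inord 0)) (P (inord 1)) (P (inord 2))
 (Q (inord 0)) (Q (inord 1)) (Q (inord 2)).
set g := gconj_coef _ _; rewrite !inE.
have n1 : (1 == 2^-1 :> R[i]) = false.
  by apply/negbTE; rewrite gt_eqF // invf_lt1 ?ltr1n.
have n2 : (2^-1 != 0 :> R[i]) by rewrite invr_eq0 pnatr_eq0.
have n3 : (2^-1 < 0 :> R[i]) = false by rewrite invr_lt0 ltrn0.
have n4 : (- 2^-1 < 0 :> R[i]) by rewrite oppr_lt0 invr_gt0 ltr0n.
have n5 : `|2^-1| = 2^-1 :> R[i] by rewrite ger0_norm // invr_ge0 ler0n.
have e4 : 8^-1 * 4 = 2^-1 :> R[i] by field.
have e8 : 8^-1 * 8 = 1 :> R[i] by field.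
case/or4P => [|||/orP[]] /eqP ->; rewrite gauss_int ?rmorphN ?mulrN ?e4 ?e8.
- by rewrite mulr0 eqxx !mul0r.
- by rewrite n2 n3 n5 eqxx !mul1r.
- by rewrite normrN oppr_eq0 n2 n4 n5 eqxx mul1r expr1 mulN1r.
- by rewrite normr1 n1 oner_eq0 ltr10 !mul1r.
- by rewrite normrN oppr_eq0 normr1 n1 oner_eq0 oppr_lt0 ltr01 mul1r expr1 mulr1.
Qed.

End TwoTerms.

(** * Transition relation, sign and weight of a gate *)

Section GateData.
Variables (R : realType) (n : nat).
Implicit Types (g : gate R n) (P Q : pauli_string n).

Definition touched g : seq 'I_n :=
  match g with
  | GH j | GS j | GT j | GRX _ j => [:: j]
  | GCZ j k _ => [:: j; k]
  | GToffoli j k l _ => [:: j; k; l]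
  end.

Definition restrict3 (j k l : 'I_n) P : pauli_string 3 :=
  [ffun i => P (tnth [tuple j; k; l] i)].

(** Concerns touched qubits only, including the x labels that the formulas of S and CZ copy in their
    frame part. *)
Definition gate_rel g P Q : bool :=
  match g with
  | GH j => Q j == ((P j).2, (P j).1)
  | GS j => Q j == ((P j).1, (P j).1 (+) (P j).2)
  | GCZ j k _ => (Q j == ((P j).1, (P j).2 (+) (P k).1)) &&
                 (Q k == ((P k).1, (P k).2 (+) (P j).1))
  | GT j => ((Q j).1 == (P j).1) && ((P j).1 || ((Q j).2 == (P j).2))
  | GToffoli j k l _ =>
      toffoli_coef R (restrict3 j k l P) (restrict3 j k l Q) != 0
  | GRX _ j => ((P j).2 || ((Q j).1 == (P j).1)) && ((Q j).2 == (P j).2)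
  end.

Definition gate_sign g P Q : bool :=
  match g with
  | GH j | GS j => (P j).1 && (P j).2
  | GCZ j k _ => (P j).1 && (P k).1 && ((P k).2 (+) (P j).2)
  | GT j => (P j).1 && (P j).2 && ~~ (Q j).2
  | GToffoli j k l _ =>
      toffoli_coef R (restrict3 j k l P) (restrict3 j k l Q) < 0
  | GRX _ j => ~~ (P j).1 && (P j).2 && (Q j).1
  end.

Definition aux_val g P Q : aux g -> bool :=
  match g return aux g -> bool with
  | GT j => fun _ => (P j).1
  | GToffoli j k l _ => fun _ =>
      `|toffoli_coef R (restrict3 j k l P) (restrict3 j k l Q)| == 2^-1
  | GRX _ j => fun i => (P j).2 && (if i then (Q j).1 == (P j).1
                                    else (Q j).1 (+) (P j).1)
  | _ => fun _ => false
  end.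

Definition frame g P Q : bool :=
  [forall k, (k \notin touched g) ==> (Q k == P k)].

(** The Pauli coefficient up to [gate_sign]. It need not be its modulus, since the cosine and sine
    weights of a rotation can be negative. *)
Definition gate_weight g P Q : R :=
  (gate_rel g P Q && frame g P Q)%:R *
  \prod_(i : aux g) (if aux_val P Q i then aux_weight i else 1).

End GateData.

(** * Explicit coefficients of the one-qubit gates *)

Section GateCoef.
Variable R : realType.

Local Notation isqrt2 := ((Num.sqrt 2)^-1 : R).

Lemma isqrt2_sqr : isqrt2 * isqrt2 = 2^-1.
Proof. by rewrite -invfM -expr2 sqr_sqrtr ?ler0n. Qed.

(** The double-angle formula gives the square, as the cosine of [pi / 2] vanishes; positivity
    selects the root. *)
Lemma cos_pi4 : cos (pi / 4) = isqrt2.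
Proof.
have c_ge0 : 0 <= cos (pi / 4 : R).
  apply/ltW/cos_gt0_pihalf; have := pi_gt0 R => pi0; apply/andP; split; lra.
apply/eqP; rewrite -(@eqrXn2 _ 2) ?invr_ge0 ?sqrtr_ge0 //; apply/eqP.
rewrite [in RHS]expr2 isqrt2_sqr.
have := cos_mulr2n (pi / 4 : R).
have -> : pi / 4 *+ 2 = pi / 2 :> R by lra.
by rewrite cos_pihalf => ?; lra.
Qed.

Lemma sin_pi4 : sin (pi / 4) = isqrt2.
Proof.
have s_ge0 : 0 <= sin (pi / 4 : R).
  by apply: sin_ge0_pi; have := pi_gt0 R => pi0; apply/andP; split; lra.
apply/eqP; rewrite -(@eqrXn2 _ 2) ?invr_ge0 ?sqrtr_ge0 //; apply/eqP.
have := cos2Dsin2 (pi / 4 : R); rewrite cos_pi4.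
by have := isqrt2_sqr; rewrite !expr2 => -> ?; lra.
Qed.

Lemma eq_real_complex (x : R[i]) (y : R) :
  complex.Re x = y -> complex.Im x = 0 -> x = y%:C.
Proof. by case: x => a b /= -> ->. Qed.

Definition gZ (a b : bool) : int[i] :=
  gint (if a == b then (if a then -1 else 1) else 0).

Lemma diag_mx2_gmx (u v : R[i]) :
  mx2 u 0 0 v = u *: gmx R (gproj false) + v *: gmx R (gproj true).
Proof.
apply/matrixP => i j; rewrite !mxE !gauss_int.
by case: (i == 0); case: (j == 0) => /=; ring.
Qed.

Lemma hadamard_gmx (u : R[i]) :
  u *: mx2 1 1 1 (-1) = u *: gmx R gX + u *: gmx R gZ.
Proof.
apply/matrixP => i j; rewrite !mxE !gauss_int.
by case: (i == 0); case: (j == 0) => /=; ring.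
Qed.

Lemma rx_gmx (u v : R[i]) : mx2 u v v u = u *: gmx R g1 + v *: gmx R gX.
Proof.
apply/matrixP => i j; rewrite !mxE !gauss_int.
by case: (i == 0); case: (j == 0) => /=; ring.
Qed.

Lemma local_coef_H (p q : bool * bool) (u := (isqrt2)%:C : R[i]) :
  2^-1 * (u * Num.conj u * gauss R (glocal_coef gX gX p q) +
   u * Num.conj u * gauss R (glocal_coef gX gZ p q) +
   u * Num.conj u * gauss R (glocal_coef gZ gX p q) +
   u * Num.conj u * gauss R (glocal_coef gZ gZ p q)) =
  ((q == (p.2, p.1))%:R * (-1) ^+ (p.1 && p.2))%:C.
Proof.
have uu : u * Num.conj u = 2^-1.
  by rewrite conj_conjc conjc_real -rmorphM isqrt2_sqr fmorphV rmorph_nat.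
rewrite !uu -!mulrDr -!gauss_add mulrA.
(* One half normalises the trace, the other is the square of [isqrt2]; the four traces add up to 4
   times a signed indicator. *)
transitivity (2^-1 * 2^-1 *
    gauss R (gint (4 * ((q == (p.2, p.1))%:Z * (-1) ^+ (p.1 && p.2))))).
  by congr (_ * gauss _ _); case: p q => [[] []] [[] []]; vm_compute.
rewrite gauss_int; case: (q == _); case: (_ && _).
all: by rewrite /= ?expr1 ?expr0 ?rmorphN ?rmorph1 ?rmorph0; field.
Qed.

Lemma half_complex : 2^-1 = 2^-1 +i* 0 :> R[i].
Proof. by rewrite -[RHS]/((2^-1)%:C) fmorphV rmorph_nat. Qed.

Lemma complex_addE (a b c d : R) : (a +i* b) + (c +i* d) = (a + c) +i* (b + d).
Proof. by []. Qed.

Lemma complex_mulE (a b c d : R) :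
  (a +i* b) * (c +i* d) = (a * c - b * d) +i* (a * d + b * c).
Proof. by []. Qed.

Ltac eval_local_coefs :=
  repeat match goal with |- context [gauss ?K (glocal_coef ?A ?B ?p ?q)] =>
    let v := eval vm_compute in (glocal_coef A B p q) in
    match v with ?a +i* ?b =>
      rewrite (_ : gauss K (glocal_coef A B p q) = a%:~R +i* b%:~R); last by []
    end end.

(** Treats S and T together as diag(1, v) with v of modulus 1: conjugation fixes I and Z and rotates
    the plane of X and Y by the argument of v. *)
Lemma local_coef_diag (a b : R) (p q : bool * bool) (v := a +i* b) :
  a ^+ 2 + b ^+ 2 = 1 ->
  2^-1 * (1 * Num.conj 1 * gauss R (glocal_coef (gproj false) (gproj false) p q) +
   1 * Num.conj v * gauss R (glocal_coef (gproj false) (gproj true) p q) +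
   v * Num.conj 1 * gauss R (glocal_coef (gproj true) (gproj false) p q) +
   v * Num.conj v * gauss R (glocal_coef (gproj true) (gproj true) p q)) =
  ((q.1 == p.1)%:R * (if p.1 then if q.2 == p.2 then a
                                  else if p.2 then - b else b
                      else (q.2 == p.2)%:R))%:C.
Proof.
move=> ab1.
have int0 : (Posz 0)%:~R = 0 :> R by [].
have int1 : (Posz 1)%:~R = 1 :> R by [].
have intN1 : (Negz 0)%:~R = - 1 :> R by [].
have vv : v * Num.conj v = 1.
  rewrite conj_conjc /v; simpc; apply/eqP.
  by rewrite eq_complex /= -ab1 -!expr2 mulrC addNr !eqxx.
rewrite !rmorph1 !mulr1 !mul1r vv mul1r /v !conj_conjc.
case: p q => [[] []] [[] []].
all: eval_local_coefs; rewrite ?(int0, int1, intN1) half_complex.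
all: rewrite ?complex_mulE ?complex_addE; apply: eq_real_complex => /=; lra.
Qed.

(** The rotation fixes I and X and turns the plane of Y and Z. With [c] and [s] at the half angle,
    the entries are double-angle expressions. *)
Lemma local_coef_RX (c s : R) (p q : bool * bool)
    (u := c%:C) (v := - 'i * s%:C) :
  c ^+ 2 + s ^+ 2 = 1 ->
  2^-1 * (u * Num.conj u * gauss R (glocal_coef g1 g1 p q) +
   u * Num.conj v * gauss R (glocal_coef g1 gX p q) +
   v * Num.conj u * gauss R (glocal_coef gX g1 p q) +
   v * Num.conj v * gauss R (glocal_coef gX gX p q)) =
  ((q.2 == p.2)%:R * (if p.2 then if q.1 == p.1 then c ^+ 2 - s ^+ 2
                                  else if p.1 then c * s *+ 2
                                  else - (c * s *+ 2)
                      else (q.1 == p.1)%:R))%:C.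
Proof.
move=> cs1.
have int0 : (Posz 0)%:~R = 0 :> R by [].
have int1 : (Posz 1)%:~R = 1 :> R by [].
have int2 : (Posz 2)%:~R = 2 :> R by [].
have intN1 : (Negz 0)%:~R = - 1 :> R by [].
have intN2 : (Negz 1)%:~R = - 2 :> R by [].
have -> : v = 0 +i* - s.
  by apply/eqP; rewrite eq_complex /=; apply/andP; split; apply/eqP; ring.
rewrite !conj_conjc {}/u.
case: p q => [[] []] [[] []].
all: eval_local_coefs; rewrite ?(int0, int1, intN1, int2, intN2) half_complex.
all: rewrite ?complex_mulE ?complex_addE; apply: eq_real_complex => /=; lra.
Qed.

End GateCoef.

Lemma toffoli_coef_restrict3 (R : realType) (n : nat) (j k l : 'I_n)
    (P Q : pauli_string n) :
  toffoli_coef R (restrict3 j k l P) (restrict3 j k l Q) =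
  8^-1 * gauss R (gconj_coef (-1)
    [:: glocal_coefs (gproj true) (P j) (Q j);
        glocal_coefs (gproj true) (P k) (Q k); glocal_coefs g1X (P l) (Q l)]).
Proof. by rewrite toffoli_coefE !ffunE !(tnth_nth j) /= !inordK. Qed.

(** Here the encoding meets the unitaries. The frame indicator is a factor of both sides; once it is
    removed, each gate leaves an identity between labels of its touched qubits. *)
Lemma pauli_coef_gate (R : realType) (n : nat) (g : gate R n)
    (P Q : pauli_string n) :
  pauli_coef (gate_mx g *m pauli_mx R P *m dagger (gate_mx g)) Q =
  ((-1) ^+ gate_sign g P Q * gate_weight g P Q)%:C.
Proof.
have natr_andb (b c : bool) : (b && c)%:R = b%:R * c%:R :> R.
  by rewrite -mulnb natrM.
have realM (b : bool) (x z : R) : z = b%:R * x -> b%:R * x%:C = z%:C.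
  by move=> ->; rewrite rmorphM rmorph_nat.
have -> : (-1) ^+ gate_sign g P Q * gate_weight g P Q = (frame g P Q)%:R *
    ((gate_rel g P Q)%:R * (-1) ^+ gate_sign g P Q *
     \prod_(i : aux g) (if aux_val P Q i then aux_weight i else 1)).
  have shuffle (a b c d : R) : a * (b * c * d) = c * (b * a * d) by ring.
  by rewrite /gate_weight natr_andb shuffle.
have realM_complex (b : bool) (x : R[i]) z :
    x = z%:C -> b%:R * x = (b%:R * z)%:C.
  by move=> ->; apply: realM.
case: g => [j|j|j k jk|j|j k l jkl|theta j].
- rewrite (pauli_coef_on_qubit _ _ _ (hadamard_gmx _)) local_coef_H.
  rewrite big_pred0 ?mulr1; last by case.
  exact: realM.
(* The phase of S is the imaginary unit, so [a = 0] and [b = 1]. *)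
- rewrite (pauli_coef_on_qubit _ _ _ (diag_mx2_gmx _ _)) (@local_coef_diag _ 0 1);
    last by rewrite expr0n expr1n add0r.
  rewrite big_pred0 ?mulr1; last by case.
  apply: realM; congr (_ * _) => /=.
  by case: (P j) (Q j) => [[] []] [[] []]; rewrite /=; ring.
- rewrite pauli_coef_cz // gconj_czE gauss_int.
  rewrite big_pred0 ?mulr1; last by case.
  apply: realM_complex; rewrite !rmorphM !rmorphXn !rmorphN !rmorph1 !rmorph_nat.
  by rewrite mulKf // pnatr_eq0.
- rewrite (pauli_coef_on_qubit _ _ _ (diag_mx2_gmx _ _)).
  rewrite local_coef_diag ?cos2Dsin2 //.
  rewrite cos_pi4 sin_pi4 (big_pred1 tt) /=; last by case.
  apply: realM; congr (_ * _).
  by case: (P j) (Q j) => [[] []] [[] []]; rewrite /=; ring.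
- rewrite pauli_coef_toffoli // -toffoli_coef_restrict3 toffoli_coef_weight.
  rewrite (big_pred1 tt) /=; last by case.
  apply: realM_complex; set c := toffoli_coef _ _ _.
  by case: (c != 0); case: (c < 0); case: (_ == _);
    rewrite /= ?expr1 ?expr0
      ?(rmorphM, rmorphN, rmorph1, rmorph0, fmorphV, rmorph_nat).
- rewrite (pauli_coef_on_qubit _ _ _ (rx_gmx _ _)) local_coef_RX ?cos2Dsin2 //.
  rewrite big_bool /=; apply: realM; congr (_ * _).
  (* The matrix is in terms of [theta / 2], the weights in terms of [theta]. *)
  have cos_theta : cos theta = cos (theta / 2) ^+ 2 - sin (theta / 2) ^+ 2.
    rewrite [in LHS](_ : theta = theta / 2 *+ 2); last by lra.
    by rewrite cos_mulr2n; have := cos2Dsin2 (theta / 2); lra.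
  have sin_theta : sin theta = cos (theta / 2) * sin (theta / 2) *+ 2.
    by rewrite [in LHS](_ : theta = theta / 2 *+ 2) ?sin_mulr2n //; lra.
  rewrite cos_theta sin_theta.
  by case: (P j) (Q j) => [[] []] [[] []]; rewrite /=; ring.
Qed.

(** * Evaluation of the encoding *)

Section Formulas.
Variable V : eqType.

Lemma feval_FAnd (alpha : V -> bool) (I : finType) (A : pred I)
    (F : I -> formula V) :
  feval alpha (\FAnd_(i in I | A i) F i) =
  [forall (i | A i), feval alpha (F i)].
Proof. by rewrite -big_andE; apply: big_morph. Qed.

Lemma mem_fvars_FAnd (v : V) (I : finType) (A : pred I) (F : I -> formula V) :
  (v \in fvars (\FAnd_(i in I | A i) F i)) =
  [exists (i | A i), v \in fvars (F i)].
Proof.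
rewrite -big_orE.
apply: (big_morph (fun G : formula V => v \in fvars G)) => // G H.
by rewrite mem_cat.
Qed.

Lemma feval_FLit (alpha : V -> bool) v b :
  feval alpha (FLit v b) = (alpha v == b).
Proof. by case: b => /=; case: (alpha v). Qed.

Lemma fvars_FLit (v : V) b : fvars (FLit v b) = [:: v].
Proof. by case: b. Qed.

Lemma feval_pauli_formula (n m : nat) (alpha : V -> bool)
    (q : 'I_m -> 'I_n) s (P : pauli_string m) :
  feval alpha (pauli_formula q s P) =
  (P == [ffun i => (alpha (s (sx (q i))), alpha (s (sz (q i))))]).
Proof.
rewrite feval_FAnd; apply/forallP/eqP => [H|-> i] /=; last first.
  by rewrite !feval_FLit ffunE !eqxx.
apply/ffunP => i; have := H i.
rewrite /= !feval_FLit ffunE => /andP[/eqP -> /eqP ->].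
by case: (P i).
Qed.

Lemma mem_fvars_pauli_formula (n m : nat) v (q : 'I_m -> 'I_n)
    (s : state_var n -> V) (P : pauli_string m) :
  (v \in fvars (pauli_formula q s P)) =
  [exists i, (v == s (sx (q i))) || (v == s (sz (q i)))].
Proof.
by rewrite mem_fvars_FAnd; apply: eq_existsb => i; rewrite /= !fvars_FLit !inE.
Qed.

End Formulas.

Section StateVar.
Variable n : nat.
Implicit Types i j : 'I_n.
Lemma sx_eq i j : (Some (inl i) == sx j :> state_var n) = (i == j).
Proof. by []. Qed.

Lemma sz_eq i j : (Some (inr i) == sz j :> state_var n) = (i == j).
Proof. by []. Qed.

Lemma sx_sz i j : (Some (inl i) == sz j :> state_var n) = false.
Proof. by []. Qed.

Lemma sz_sx i j : (Some (inr i) == sx j :> state_var n) = false.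
Proof. by []. Qed.

End StateVar.

(** * Semantics of the gate constraints *)

Section GateFormula.
Variables (R : realType) (n : nat).
Implicit Types (g : gate R n).

Definition state : finType := (pauli_string n * bool)%type.

Definition state_val (s : state) (a : state_var n) : bool :=
  match a with
  | Some (inl j) => (s.1 j).1
  | Some (inr j) => (s.1 j).2
  | None => s.2
  end.

(* The touched qubits whose x label the gate formula copies in its frame part
   instead of listing an equation for it. *)
Definition keeps_x g : seq 'I_n :=
  match g with GS _ | GCZ _ _ _ => touched g | _ => [::] end.

Definition written g (a : state_var n) : bool :=
  match a with
  | Some (inl j) => (j \in touched g) && (j \notin keeps_x g)
  | Some (inr j) => j \in touched g
  | None => true
  end.

Variables (V : eqType) (cur nxt : state_var n -> V).
Hypothesis nxt_inj : injective nxt.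
Hypothesis nxt_cur : forall a b, (nxt a == cur b) = false.

Lemma mem_fvars_listed g (u : aux g -> V) a :
  (forall i, (nxt a == u i) = false) ->
  (nxt a \in fvars (listed_formula cur nxt u)) = written g a.
Proof.
case: g u => [j|j|j k jk|j|j k l jkl|theta j] u nxt_u.
5: {
  rewrite /= /toffoli_formula; set q := tnth _.
  have in_body P Q : (nxt a \in fvars (FImp
      (FAnd (pauli_formula q cur P) (pauli_formula q nxt Q))
      (let c := toffoli_coef R P Q in
       FAnd (FAnd (FConst (c != 0))
         (FIff (FVar (nxt sr)) (FXor (FVar (cur sr)) (FConst (c < 0)))))
       (FIff (FVar (u tt)) (FConst (`|c| == 2^-1)))))) =
      written (GToffoli R jkl) a.
    rewrite /= !mem_cat !inE !mem_fvars_pauli_formula nxt_u !nxt_cur !orbF.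
    rewrite (_ : [exists i, _] = false) /=; last first.
      by apply/existsP => -[h]; rewrite !nxt_cur.
    under eq_existsb => i do rewrite !(inj_eq nxt_inj).
    rewrite (inj_eq nxt_inj).
    have in_q i : [exists h, i == q h] = (i \in [:: j; k; l]).
      by apply/existsP/(tnthP [tuple j; k; l]) => -[h /eqP];
        exists h => //; apply/eqP.
    case: (a) => [[i|i]|]; last by rewrite eqxx orbT.
    - under eq_existsb => h do rewrite sx_eq sx_sz orbF.
      by rewrite orbF in_q /= andbT.
    - under eq_existsb => h do rewrite sz_eq sz_sx orFb.
      by rewrite orbF in_q.
  rewrite mem_fvars_FAnd; apply/existsP/idP => [[P]|wa].
    by rewrite mem_fvars_FAnd => /existsP[Q]; rewrite in_body.
  (* Any two strings serve as witnesses: by [in_body] every conjunct mentions the same next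
     variables. *)
  exists [ffun=> (false, false)]; rewrite mem_fvars_FAnd; apply/existsP.
  by exists [ffun=> (false, false)]; rewrite in_body.
}
all: rewrite /= ?mem_cat ?inE ?nxt_u ?nxt_cur ?(inj_eq nxt_inj) ?orbF.
all: case: a nxt_u => [[i|i]|] _; rewrite ?(sx_eq, sz_eq, sx_sz, sz_sx) /= ?inE.
all: by rewrite ?(andbT, orbF, orbb, andbN) // orbC.
Qed.

(** The variables that are not written are both labels of untouched qubits and the x labels in
    [keeps_x]; [r] is always written. *)
Lemma frame_split g (s s' : state) :
  [forall (a | ~~ written g a), state_val s' a == state_val s a] =
  frame g s.1 s'.1 && all (fun j => (s'.1 j).1 == (s.1 j).1) (keeps_x g).
Proof.
apply/forall_inP/andP => [H|[/forall_inP fr /allP kx] [[j|j]|]] //=.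
- split; last first.
    by apply/allP => j jx; apply: (H (sx j)); rewrite /= jx andbF.
  apply/forall_inP => k kt.
  rewrite [s'.1 k]surjective_pairing [s.1 k]surjective_pairing.
  have /= := H (sx k); have /= := H (sz k); rewrite (negbTE kt) /=.
  by move=> /(_ isT)/eqP -> /(_ isT)/eqP ->.
- rewrite negb_and negbK => /orP[/fr /eqP -> //|/kx //].
- by move/fr/eqP ->.
Qed.

Variables (alpha : V -> bool) (s s' : state).
Hypothesis cur_val : forall a, alpha (cur a) = state_val s a.
Hypothesis nxt_val : forall a, alpha (nxt a) = state_val s' a.

(** Only one pair of strings satisfies the premise of its implication, namely the pair of restricted
    labels. *)
Lemma feval_toffoli_formula (j k l : 'I_n) (u : V)
    (c := toffoli_coef R (restrict3 j k l s.1) (restrict3 j k l s'.1)) :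
  feval alpha (toffoli_formula R cur nxt j k l u) =
  [&& c != 0, s'.2 == s.2 (+) (c < 0) & alpha u == (`|c| == 2^-1)].
Proof.
have restrictE (r : state) t : (forall a, alpha (t a) = state_val r a) ->
    [ffun i => (alpha (t (sx (tnth [tuple j; k; l] i))),
                alpha (t (sz (tnth [tuple j; k; l] i))))] = restrict3 j k l r.1.
  move=> tE; apply/ffunP => i; rewrite !ffunE !tE /=.
  by rewrite -surjective_pairing.
rewrite feval_FAnd.
under eq_forallb => P do rewrite feval_FAnd /=.
transitivity [forall P, forall Q,
   (P == restrict3 j k l s.1) && (Q == restrict3 j k l s'.1) ==>
   [&& toffoli_coef R P Q != 0, s'.2 == s.2 (+) (toffoli_coef R P Q < 0)
     & alpha u == (`|toffoli_coef R P Q| == 2^-1)]].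
  apply: eq_forallb => P; apply: eq_forallb => Q.
  rewrite !feval_pauli_formula (restrictE _ _ cur_val) (restrictE _ _ nxt_val).
  by rewrite /= cur_val nxt_val andbA.
apply/forallP/idP => [H|H P].
  have /forallP/(_ (restrict3 j k l s'.1)) := H (restrict3 j k l s.1).
  by rewrite !eqxx.
by apply/forallP => Q; apply/implyP => /andP[/eqP -> /eqP ->].
Qed.

(** The frame equations split by [frame_split]; those for kept x labels are absorbed into
    [gate_rel], and the rest is propositional. *)
Lemma feval_gate_formula g (u : aux g -> V) :
  (forall a i, (nxt a == u i) = false) ->
  feval alpha (gate_formula cur nxt u) =
  [&& gate_rel g s.1 s'.1 && frame g s.1 s'.1,
      s'.2 == s.2 (+) gate_sign g s.1 s'.1
    & [forall i, alpha (u i) == aux_val s.1 s'.1 i]].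
Proof.
move=> nxt_u; rewrite /gate_formula [LHS]/= feval_FAnd.
rewrite (eq_forallb (P2 := fun a =>
  ~~ written g a ==> (state_val s' a == state_val s a))); last first.
  by move=> a; rewrite mem_fvars_listed //= cur_val nxt_val.
rewrite -/([forall (a | ~~ written g a), _]) frame_split.
have eq_pair (q : bool * bool) a b : (q == (a, b)) = (q.1 == a) && (q.2 == b).
  by case: q.
have void_forall (p : pred void) : [forall i, p i] = true.
  by apply/forallP; case.
have unit_forall (p : pred unit) : [forall i, p i] = p tt.
  by apply/forallP/idP => [/(_ tt)|? []].
have bool_forall (p : pred bool) : [forall i, p i] = p true && p false.
  by apply/forallP/andP => [H|[? ?] []].
case: g u {nxt_u} => [j|j|j k jk|j|j k l jkl|theta j] u.
5: {
  rewrite /= unit_forall feval_toffoli_formula andbT /=.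
  by set f := frame _ _ _; case: f; rewrite ?andbF ?andbT // andbC.
}
all: rewrite /= ?cur_val ?nxt_val ?void_forall ?unit_forall ?bool_forall /=.
all: set f := frame _ _ _; case: f; rewrite ?andbF ?andbT //.
all: case: s s' => P r [Q r'] /=.
4,5: by rewrite !andbA.
all: rewrite !eq_pair; move: (r' == _) => br.
- by rewrite -andbA andbC [X in X && _]andbC.
- by rewrite -andbA andbC [X in X && _]andbC.
- move: ((Q j).1 == _) ((Q j).2 == _) ((Q k).1 == _) ((Q k).2 == _).
  by case: br => -[] [] [] [].
Qed.

End GateFormula.

(** * Model counts as sums over paths *)

Section Paths.
Variables (K : pzRingType) (G : Type) (T : finType).
Variables (k : G -> T -> T -> K) (B : T -> K).

(** The transfer-matrix product with kernels [k], applied to the boundary vector [B]. *)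
Fixpoint path_sum (C : seq G) (s : T) : K :=
  if C is g :: C' then \sum_s' k g s s' * path_sum C' s' else B s.

Lemma path_sumE (m : nat) (C : m.-tuple G) (s : T) :
  \sum_(S : {ffun 'I_m.+1 -> T} | S ord0 == s)
    (\prod_(t < m)
       k (tnth C t) (S (widen_ord (leqnSn m) t)) (S (lift ord0 t))) *
    B (S ord_max) = path_sum C s.
Proof.
elim: m C s => [|m IHm] C s.
  rewrite tuple0 /= (big_pred1 [ffun=> s]) => [|S].
    by rewrite big_ord0 mul1r ffunE.
  rewrite /=; apply/eqP/eqP => [<-|->]; last by rewrite ffunE.
  by apply/ffunP => i; rewrite ffunE (ord1 i).
case/tupleP: C => g C.
(* Paths starting at [s] are the shorter paths with [s] prepended; index 0, where [unlift] fails,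
   takes the default [s]. *)
pose cons (S : {ffun 'I_m.+1 -> T}) : {ffun 'I_m.+2 -> T} :=
  [ffun i => oapp S s (unlift ord0 i)].
have cons0 S : cons S ord0 = s by rewrite ffunE unlift_none.
have consS S i : cons S (lift ord0 i) = S i by rewrite ffunE liftK.
rewrite (reindex cons) /=; last first.
  exists (fun S => [ffun i => S (lift ord0 i)]) => S.
    by move=> _; apply/ffunP => i; rewrite ffunE consS.
  move=> /eqP S0; apply/ffunP => i; rewrite ffunE.
  by case: unliftP => [j ->|->] /=; rewrite ?ffunE.
rewrite (eq_bigl predT) => [|S]; last by rewrite cons0 eqxx.
(* Group the paths by the state after the first step. *)
rewrite (partition_big (fun S : {ffun 'I_m.+1 -> T} => S ord0) predT) //=.
apply: eq_bigr => s' _; rewrite -IHm mulr_sumr; apply: eq_bigr => S /eqP S0.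
rewrite big_ord_recl mulrA tnth0; congr (_ * _ * _).
- by rewrite (_ : widen_ord _ _ = ord0) ?cons0 ?consS ?S0 //; apply: val_inj.
- apply: eq_bigr => t _; rewrite tnthS consS.
  rewrite (_ : widen_ord _ _ = lift ord0 (widen_ord (leqnSn m) t)) ?consS //.
  exact: val_inj.
- by rewrite (_ : ord_max = lift ord0 ord_max) ?consS //; apply: val_inj.
Qed.

End Paths.

(** * Path sums of a circuit as Pauli coefficients *)

Section CircuitValue.
Variables (R : realType) (n : nat).
Implicit Types (g : gate R n) (P Q : pauli_string n).

(** [gate_sign] is not multiplied in: it accumulates in the bit of the state and becomes a factor -1
    only in [final_weight]. *)
Definition step_weight g (s s' : state n) : R :=
  gate_weight g s.1 s'.1 * (s'.2 == s.2 (+) gate_sign g s.1 s'.1)%:R.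

Definition final_weight P (s : state n) : R := (s.1 == P)%:R * (-1) ^+ s.2.

Lemma circuit_mx_cons g (C : seq (gate R n)) :
  circuit_mx (g :: C) = circuit_mx C *m gate_mx g.
Proof.
suff H (A : 'M[R[i]]_(2 ^ n)) :
    foldl (fun A g => gate_mx g *m A) A C = circuit_mx C *m A.
  by rewrite {1}/circuit_mx /= H mulmx1.
rewrite /circuit_mx; elim: C A => [|h C IHC] A /=; first by rewrite mul1mx.
by rewrite IHC [in RHS]IHC mulmx1 mulmxA.
Qed.

(** Induction on the circuit for every sign bit [r]: expand the image of [Q] under the first gate in
    the Pauli basis and use linearity of the remaining conjugation. *)
Lemma path_sum_circuit (C : seq (gate R n)) P Q r :
  (path_sum step_weight (final_weight P) C (Q, r))%:C =
  (-1) ^+ r *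
  pauli_coef (circuit_mx C *m pauli_mx R Q *m dagger (circuit_mx C)) P.
Proof.
elim: C Q r => [|g C IHC] Q r.
  rewrite /circuit_mx /= mul1mx dagger1 mulmx1 pauli_coef_basis.
  rewrite /final_weight rmorphM rmorphXn rmorphN rmorph1 rmorph_nat.
  by rewrite mulrC eq_sym.
rewrite circuit_mx_cons daggerM.
rewrite [X in pauli_coef X](_ : _ = circuit_mx C *m
   (gate_mx g *m pauli_mx R Q *m dagger (gate_mx g)) *m
   dagger (circuit_mx C)); last first.
  by rewrite !mulmxA.
rewrite [gate_mx g *m _ *m _]pauli_expansion mulmx_sumr mulmx_suml.
under [X in pauli_coef X]eq_bigr => Q' _ do rewrite -scalemxAr -scalemxAl.
rewrite pauli_coef_sum mulr_sumr.
transitivity (\sum_Q' \sum_r' (step_weight g (Q, r) (Q', r') *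
    path_sum step_weight (final_weight P) C (Q', r'))%:C).
  by rewrite pair_bigA /= raddf_sum; apply: eq_bigr => -[].
apply: eq_bigr => Q' _.
(* The next sign bit is determined, so one term survives. *)
rewrite (bigD1 (r (+) gate_sign g Q Q')) //= big1 ?addr0 => [|r' /negbTE r'E].
  rewrite rmorphM /= IHC pauli_coef_gate /step_weight eqxx mulr1.
  have shuffle (a b c d : R[i]) : a * (b * c * d) = b * (c * a * d) by ring.
  rewrite signr_addb shuffle [in RHS]rmorphM [in RHS]rmorphXn.
  by rewrite rmorphN rmorph1.
by rewrite /step_weight /= r'E mulr0 mul0r.
Qed.

End CircuitValue.

(** * From assignments to paths *)

Section ModelCount.
Variables (R : realType) (n m : nat) (C : m.-tuple (gate R n)).

Local Notation aux_index := {t : 'I_m & aux (tnth C t)}.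
Local Notation pre t := (widen_ord (leqnSn m) t).
Local Notation post t := (lift ord0 t).

Definition assignment (S : {ffun 'I_m.+1 -> state n})
    (b : {ffun aux_index -> bool}) :
  {ffun var C -> bool} :=
  [ffun v => match v with inl (a, t) => state_val (S t) a | inr i => b i end].

Lemma assignment_bij : bijective (fun p => assignment p.1 p.2).
Proof.
exists (fun alpha : {ffun var C -> bool} =>
  ([ffun t => ([ffun j => (alpha (at_time C t (sx j)),
                           alpha (at_time C t (sz j)))],
               alpha (at_time C t sr))],
   [ffun i => alpha (inr i)])).
  move=> [S b]; congr (_, _); apply/ffunP => t; rewrite !ffunE //=.
  rewrite [RHS]surjective_pairing; congr (_, _); apply/ffunP => j.
  by rewrite !ffunE /= -surjective_pairing.
move=> alpha; apply/ffunP => -[[a t]|i]; rewrite !ffunE //.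
by case: a => [[j|j]|]; rewrite /= ?ffunE.
Qed.

Definition path_aux (S : {ffun 'I_m.+1 -> state n}) (v : aux_index) : bool :=
  aux_val (g := tnth C (tag v)) (S (pre (tag v))).1 (S (post (tag v))).1
    (tagged v).

Lemma feval_pauli_at (alpha : var C -> bool) t s (P : pauli_string n) :
  (forall a, alpha (at_time C t a) = state_val s a) ->
  feval alpha (pauli_formula id (at_time C t) P) = (s.1 == P).
Proof.
move=> alphaE; rewrite feval_pauli_formula eq_sym; congr (_ == _).
by apply/ffunP => j; rewrite ffunE !alphaE /= -surjective_pairing.
Qed.

Lemma feval_circuit (S : {ffun 'I_m.+1 -> state n}) b (P0 P : pauli_string n) :
  feval (assignment S b) (FAnd (circuit_formula C P0) (final_formula C P)) =
  [&& S ord0 == (P0, false), (S ord_max).1 == P,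
      [forall t, (gate_rel (tnth C t) (S (pre t)).1 (S (post t)).1 &&
                  frame (tnth C t) (S (pre t)).1 (S (post t)).1) &&
        ((S (post t)).2 == (S (pre t)).2 (+)
            gate_sign (tnth C t) (S (pre t)).1 (S (post t)).1)]
    & [forall v, b v == path_aux S v]].
Proof.
have stE t a : assignment S b (at_time C t a) = state_val (S t) a.
  by rewrite ffunE.
rewrite /= (feval_pauli_at _ (stE ord0)) (feval_pauli_at _ (stE ord_max)).
rewrite stE feval_FAnd.
have -> : (S ord0 == (P0, false)) = ((S ord0).1 == P0) && ~~ (S ord0).2.
  by case: (S ord0) => Q r; rewrite xpair_eqE eqbF_neg.
rewrite -!andbA; congr [&& _, _ & _]; rewrite [LHS]andbC.
congr (_ && _).
transitivity [forall t, ((gate_rel (tnth C t) (S (pre t)).1 (S (post t)).1 &&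
                  frame (tnth C t) (S (pre t)).1 (S (post t)).1) &&
        ((S (post t)).2 == (S (pre t)).2 (+)
            gate_sign (tnth C t) (S (pre t)).1 (S (post t)).1)) &&
     [forall i : aux (tnth C t), b (@Tagged _ t (fun t => aux (tnth C t)) i) ==
                aux_val (S (pre t)).1 (S (post t)).1 i]].
  apply: eq_forallb => t; rewrite /step_formula.
  rewrite (feval_gate_formula _ _ (stE (pre t)) (stE (post t))) //.
  - rewrite andbA; congr (_ && _); apply: eq_forallb => i.
    by rewrite ffunE.
  - by move=> a1 a2 [].
  (* Current and next copies differ, since equality would force t + 1 = t. *)
  - move=> a1 a2; apply/negbTE/eqP => -[_].
    by rewrite /bump /= add1n => /esym /n_Sn.
apply/forallP/andP => [H|[/forallP H1 /forallP H2] t].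
  split; apply/forallP.
    by move=> t; have /andP[] := H t.
  by case=> t i; have /andP[_ /forallP] := H t; apply.
rewrite H1; apply/forallP => i.
exact: (H2 (@Tagged _ t (fun t => aux (tnth C t)) i)).
Qed.

Lemma weight_assignment (S : {ffun 'I_m.+1 -> state n}) b :
  \prod_v weight v (assignment S b v) =
  (-1) ^+ (S ord_max).2 * \prod_(v : aux_index) weight (C := C) (inr v) (b v).
Proof.
rewrite big_sumType /=; congr (_ * _); last first.
  by apply: eq_bigr => v _; rewrite ffunE.
rewrite (bigD1 (sr, ord_max)) //= big1 ?mulr1 => [|[a t]].
  by rewrite ffunE /= !eqxx /=; case: (S _).2.
by rewrite xpair_eqE; case: (a == _); case: (t == _); rewrite //= ffunE.
Qed.

Lemma model_count_path_sum (P0 P : pauli_string n) :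
  model_count (weight (C := C))
    (FAnd (circuit_formula C P0) (final_formula C P)) =
  path_sum (@step_weight R n) (final_weight R P) C (P0, false).
Proof.
rewrite -path_sumE /model_count (reindex _ (onW_bij _ assignment_bij)).
pose term S b := (feval (assignment S b)
   (FAnd (circuit_formula C P0) (final_formula C P)))%:R *
   \prod_v weight v (assignment S b v).
transitivity (\sum_S \sum_b term S b); first by rewrite pair_bigA.
rewrite [RHS]big_mkcond; apply: eq_bigr => S _.
rewrite /term; under eq_bigr => b _ do rewrite feval_circuit weight_assignment.
case: ifP => _; last by rewrite big1 // => b _; rewrite mul0r.
have stepE g s s' : step_weight g s s' =
    ((gate_rel g s.1 s'.1 && frame g s.1 s'.1) &&
      (s'.2 == s.2 (+) gate_sign g s.1 s'.1))%:R *
    \prod_(i : aux g) (if aux_val s.1 s'.1 i then aux_weight i else 1) :> R.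
  by rewrite /step_weight /gate_weight mulrAC -natrM mulnb.
under [in RHS]eq_bigr => t _ do rewrite stepE.
rewrite [in RHS]big_split /= prodr_natb /final_weight.
set r := [forall t, _] : bool;
set e := (_ == P); set w := (-1) ^+ _; set auxs := \prod_(t < m) _.
(* For a fixed path the constraint on [b] is a product over the auxiliary variables, so the sum over
   [b] factors and each factor keeps only the value [path_aux S v]. *)
transitivity (e%:R * w * r%:R *
  \sum_(b : {ffun aux_index -> bool})
   \prod_v ((b v == path_aux S v)%:R * weight (C := C) (inr v) (b v))).
  rewrite mulr_sumr; apply: eq_bigr => b _; rewrite big_split /= prodr_natb.
  have shuffle (x y z t f : R) :
      x * (y * z) * (t * f) = x * t * y * (z * f) by ring.
  by rewrite -!mulnb !natrM shuffle.
rewrite -(bigA_distr_bigA (fun v x =>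
  (x == path_aux S v)%:R * weight (C := C) (inr v) x)) /=.
rewrite (eq_bigr (fun v => weight (C := C) (inr v) (path_aux S v))); last first.
  move=> v _; rewrite (bigD1 (path_aux S v)) //= eqxx mul1r big1 ?addr0 //.
  by move=> x /negbTE ->; rewrite mul0r.
have -> : \prod_v weight (C := C) (inr v) (path_aux S v) = auxs.
  rewrite /auxs sig_big_dep /=; apply: eq_bigr => -[t i] _ //.
by rewrite [RHS]mulrC mulrA.
Qed.

End ModelCount.

Theorem proposition1 (R : realType) (n m : nat) (hn : (1 <= n)%N)
    (hm : (1 <= m)%N) (C : m.-tuple (gate R n)) (P0 P : pauli_string n)
    (hP0 : exists j : 'I_n,
        pauli_mx R P0 = on_qubit (sigma R (true, false)) j \/
        pauli_mx R P0 = on_qubit (sigma R (false, true)) j) :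
  let A : 'M[R[i]]_(2 ^ n) := circuit_mx C in
  (model_count (weight (C := C))
     (FAnd (circuit_formula C P0) (final_formula C P)))%:C
  = (2 ^ n)%:R^-1 *
    \tr (dagger (pauli_mx R P) *m (A *m pauli_mx R P0 *m dagger A)).
(* The initial sign bit is [false], so the sign in [path_sum_circuit] is 1. *)
Proof. by move=> A; rewrite model_count_path_sum path_sum_circuit mul1r. Qed.
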